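(* Let $f:\Omega\times\mathbb S^1\to\mathbb S^1$ be a uniquely ergodic random map of $C^1$ diffeomorphisms of the circle, over a Bernoulli product space $(\Omega,\mathscr F,\mathbb P)$, such that $\|\log|f'_\omega|\,\|_\infty$ is $\mathbb P$-integrable, and let $\mu$ be its unique stationary probability measure. Then, for any $x\in\mathbb S^1$, $$\lim_{n\to\infty}\frac1n\log|(f^n_\omega)'(x)|=\lambda(\mu)\qquad\text{for }\mathbb P\text{-a.e. }\omega\in\Omega.$$
   Context: $(\Omega,\mathscr F,\mathbb P)=(T^{\mathbb N},\mathscr A^{\mathbb N},p^{\mathbb N})$. A (Bernoulli) random map is a measurable $f:\Omega\times\mathbb S^1\to\mathbb S^1$ with $f_\omega:=f(\omega,\cdot)=f_{\omega_0}$ for $\mathbb P$-a.e. $\omega$ (here $f_\omega$ is a $C^1$ diffeomorphism a.s.); $f^n_\omega=f_{\omega_{n-1}}\circ\cdots\circ f_{\omega_0}$. A probability measure $\mu$ is $f$-stationary if $\mathbb P\times\mu$ is invariant under $(\omega,x)\mapsto(\sigma\omega,f_\omega(x))$, $\sigma$ the shift; $f$ is uniquely ergodic if there is exactly one such $\mu$. $\lambda(\mu)=\lim_n\frac1n\int\log|(f^n_\omega)'(x)|\,d\mathbb P\,d\mu$. *)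

(* Defs.v *)
From HB Require Import structures.
From mathcomp Require Import all_boot all_order all_algebra.
From mathcomp Require Import all_classical all_reals all_analysis.
From mathcomp Require Import ring.
Set Implicit Arguments.
Unset Strict Implicit.
Unset Printing Implicit Defensive.
Import Order.TTheory GRing.Theory Num.Theory.
Import numFieldNormedType.Exports.
Local Open Scope classical_set_scope.
Local Open Scope ring_scope.

(* The circle is the unit circle of R^2, with the topology induced by R^2 and
   its Borel sigma-algebra. *)
Definition unit_circle (R : realType) : set (R * R) :=
  [set z | z.1 ^+ 2 + z.2 ^+ 2 = 1].

Definition circle (R : realType) : Type := set_type (@unit_circle R).

HB.instance Definition _ (R : realType) :=
  Topological.copy (circle R) (set_type (@unit_circle R)).

Lemma rotate_subproof (R : realType) (t : R) (x : circle R) :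
  ((val x).1 * cos t - (val x).2 * sin t,
   (val x).1 * sin t + (val x).2 * cos t) \in @unit_circle R.
Proof.
apply/mem_set; rewrite /unit_circle /=.
have /set_mem := valP x; rewrite /unit_circle /= => hx.
have hcs := cos2Dsin2 t.
transitivity (((val x).1 ^+ 2 + (val x).2 ^+ 2) * (cos t ^+ 2 + sin t ^+ 2)).
  by ring.
by rewrite hx hcs mulr1.
Qed.

Definition rotate (R : realType) (t : R) (x : circle R) : circle R :=
  SigSub (rotate_subproof t x).

Lemma circle_point_subproof (R : realType) : (1, 0) \in @unit_circle R.
Proof. by apply/mem_set; rewrite /unit_circle /= expr1n expr0n addr0. Qed.

HB.instance Definition _ (R : realType) :=
  isPointed.Build (circle R) (SigSub (circle_point_subproof R)).

HB.instance Definition _ (R : realType) :=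
  Measurable.copy (circle R) (g_sigma_algebraType (@open (circle R))).

(* Near x, the circle is parametrized by arc length through t |-> rotate t x;
   circle_arc1 g x and circle_arc2 g x are the coordinates in R^2 of the image
   by g of this parametrization. *)
Definition circle_arc1 (R : realType) (g : circle R -> circle R)
    (x : circle R) (t : R) : R := (val (g (rotate t x))).1.

Definition circle_arc2 (R : realType) (g : circle R -> circle R)
    (x : circle R) (t : R) : R := (val (g (rotate t x))).2.

(* The velocity v of the image arc at t = 0 is tangent to the circle at
   y = g x, and the derivative of g at x is the coordinate of v along the
   positively oriented unit tangent vector (- y.2, y.1). *)
Definition circle_deriv (R : realType) (g : circle R -> circle R)
    (x : circle R) : R :=
  let y := val (g x) in
  y.1 * derive1 (circle_arc2 g x) 0 - y.2 * derive1 (circle_arc1 g x) 0.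

Definition circle_C1 (R : realType) (g : circle R -> circle R) : Prop :=
  (forall x, derivable (circle_arc1 g x) 0 1 /\
             derivable (circle_arc2 g x) 0 1) /\
  continuous (circle_deriv g).

Definition circle_C1_diffeo (R : realType) (g : circle R -> circle R) : Prop :=
  circle_C1 g /\
  exists h, [/\ cancel g h, cancel h g & circle_C1 h].

(* || log |g'| ||_oo *)
Definition log_deriv_norm (R : realType) (g : circle R -> circle R) : \bar R :=
  ereal_sup [set `|ln `|circle_deriv g x| |%:E | x in [set: circle R]].

Definition paths (T : Type) : Type := nat -> T.

HB.instance Definition _ (T : pointedType) :=
  isPointed.Build (paths T) (fun=> point).

(* The product sigma-algebra is generated by the preimages of measurable sets
   by the coordinate maps. *)
HB.instance Definition _ d (T : measurableType d) :=
  Measurable.copy (paths T)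
    (g_sigma_algebraType [set C : set (paths T) | exists i (A : set T),
       measurable A /\ C = [set w | A (w i)]]).

(* P is the product measure p^N: by Dynkin's pi-lambda theorem it is the only
   probability measure with these values on cylinders. *)
Definition is_product_measure d (T : measurableType d) (R : realType)
    (p : probability T R) (P : probability (paths T) R) : Prop :=
  forall (n : nat) (A : nat -> set T), (forall i, measurable (A i)) ->
    P [set w | forall i, (i < n)%N -> A i (w i)] =
    (\prod_(i < n) p (A i))%E.

Definition path_shift (T : Type) (w : paths T) : paths T := fun n => w n.+1.

Section random_maps.
Context d (T : measurableType d) (R : realType).
Variable P : probability (paths T) R.

(* f is a random map, and f0 : T -> circle R -> circle R is the family of maps
   on which it depends through the first coordinate only. *)
Definition random_map (f : paths T * circle R -> circle R)
    (f0 : T -> circle R -> circle R) : Prop :=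
  measurable_fun [set: paths T * circle R] f /\
  {ae P, forall w, forall x, f (w, x) = f0 (w 0%N) x}.

Fixpoint cocycle (f0 : T -> circle R -> circle R) (n : nat) (w : paths T) :
    circle R -> circle R :=
  if n is m.+1 then f0 (w m) \o cocycle f0 m w else id.

Definition skew_product (f : paths T * circle R -> circle R)
    (z : paths T * circle R) : paths T * circle R := (path_shift z.1, f z).

Definition stationary (f : paths T * circle R -> circle R)
    (mu : probability (circle R) R) : Prop :=
  forall A : set (paths T * circle R), measurable A ->
    (P \x mu)%E (skew_product f @^-1` A) = (P \x mu)%E A.

Definition uniquely_ergodic (f : paths T * circle R -> circle R) : Prop :=
  exists mu, stationary f mu /\
    forall nu, stationary f nu -> forall A, measurable A -> nu A = mu A.

(* Integrability of a function which is only meaningful almost everywhere. *)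
Definition ae_integrable (h : paths T -> \bar R) : Prop :=
  exists2 k, P.-integrable [set: paths T] k & ae_eq P [set: paths T] h k.

Definition lyapunov (f0 : T -> circle R -> circle R)
    (mu : probability (circle R) R) : \bar R :=
  lim ((fun n : nat => (n%:R^-1)%:E *
    \int[P \x mu]_z (ln `|circle_deriv (cocycle f0 n z.1) z.2|)%:E)%E @ \oo).

End random_maps.

(* Main.v *)
(* Let X_k = f^k_w(x). By the chain rule log |(f^n_w)'(x)| is the sum over k < n
   of phi(w_k, X_k) with phi(t, y) = log |f_t'(y)|, which is continuous in y and
   dominated by an integrable function of t. It remains to prove a strong law of
   large numbers for these sums, from every starting point x.

   Truncating phi in t costs an error controlled along almost every path by the
   maximal ergodic inequality. For bounded phi, let g be the average of phi over
   t and c the integral of g with respect to mu. Since the stationary measure is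
   unique, the averages A_n g of g under the transfer operator Q converge to c
   uniformly: otherwise an ultrafilter limit of A_n at bad points would be a
   positive functional which, by Riesz' theorem, is the integral for a second
   stationary measure.
   With h - Q h = g - A_n g, the sum of phi(w_k, X_k) - A_n g(X_k) is, up to a
   bounded term, a sum of bounded martingale differences, which is o(n) almost
   surely by an exponential moment bound and the Borel-Cantelli lemma. *)
Require Import Defs.
From HB Require Import structures.
From mathcomp Require Import all_boot all_order all_algebra.
From mathcomp Require Import all_classical all_reals all_analysis.
From mathcomp Require Import measurable_realfun.
From mathcomp Require Import ring lra.
Set Implicit Arguments.
Unset Strict Implicit.
Unset Printing Implicit Defensive.
Import Order.TTheory GRing.Theory Num.Theory.
Import numFieldNormedType.Exports.
Local Open Scope classical_set_scope.
Local Open Scope ring_scope.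

(** * Differentiable maps of the circle *)

(** An ergodic theorem for the skew product would give the limit only for [mu]-almost every starting
    point. For a prescribed [x] one needs control that is uniform over the circle; unique ergodicity
    and compactness provide it, but only for averages of continuous functions. This is why
    continuity of [phi] in its second variable is preserved at every reduction.

    Two obstacles come from the form of the hypotheses. The maps are known only up to null sets and
    nothing is said about the measurability of [f0], so the proof works with a jointly measurable
    family [F] of diffeomorphisms, obtained from [f] by fixing the tail of the path, which agrees
    with the given maps along almost every path. Moreover, stationarity and the exponent are stated
    on the path space: independence of the first letter and the tail reduces stationarity to
    invariance of a law under one random step, and stationarity makes the integral in [lyapunov]
    exactly [n] times that of [phi], so that the sequence defining the exponent is constant from
    [n = 1] on. *)

Section continuous_real_functions.
Context (V : topologicalType) (R : realType).
Implicit Types f g : V -> R.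

Lemma continuous_add f g :
  continuous f -> continuous g -> continuous (fun x => f x + g x).
Proof. by move=> cf cg x; apply: (@cvgD R R^o); [exact: cf|exact: cg]. Qed.

Lemma continuous_mul f g :
  continuous f -> continuous g -> continuous (fun x => f x * g x).
Proof. by move=> cf cg x; apply: cvgM; [exact: cf|exact: cg]. Qed.

Lemma continuous_opp f : continuous f -> continuous (fun x => - f x).
Proof. by move=> cf x; apply: (@cvgN R R^o); exact: cf. Qed.

Lemma continuous_sub f g :
  continuous f -> continuous g -> continuous (fun x => f x - g x).
Proof. by move=> cf cg; exact: continuous_add cf (continuous_opp cg). Qed.

Lemma continuous_const (r : R) : continuous (fun _ : V => r).
Proof. by move=> x; exact: cvg_cst. Qed.

Lemma continuous_normr f : continuous f -> continuous (fun x => `|f x|).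
Proof. by move=> cf x; apply: cvg_norm; exact: cf. Qed.

Lemma continuous_minr f g :
  continuous f -> continuous g -> continuous (fun x => Num.min (f x) (g x)).
Proof. by move=> cf cg x; exact: (continuous_min (cf x) (cg x)). Qed.

Lemma continuous_maxr f g :
  continuous f -> continuous g -> continuous (fun x => Num.max (f x) (g x)).
Proof. by move=> cf cg x; exact: (continuous_max (cf x) (cg x)). Qed.

Lemma continuous_sumr n (h : nat -> V -> R) : (forall i, continuous (h i)) ->
  continuous (fun x => \sum_(i < n) h i x).
Proof.
move=> ch; elim: n => [|n ih].
  by under eq_fun do rewrite big_ord0; exact: continuous_const.
by under eq_fun do rewrite big_ord_recr; exact: continuous_add.
Qed.

Lemma continuous_nearP f :
  (forall x e, 0 < e -> \forall y \near x, `|f x - f y| < e) -> continuous f.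
Proof. by move=> h x; apply/cvgrPdist_lt => e; exact: h. Qed.

Lemma near_continuous_gt f x c :
  continuous f -> c < f x -> \forall y \near x, c < f y.
Proof. by move=> cf cx; apply: (cvgr_gt (f x)) => //; exact: cf. Qed.

Lemma open_gt_continuous f c : continuous f -> open [set x | c < f x].
Proof.
move=> cf; rewrite (_ : mkset _ = f @^-1` [set r | c < r]) //.
by apply: open_comp; [move=> x _; exact: cf|exact: open_gt].
Qed.

End continuous_real_functions.

Section circle_geometry.
Context (R : realType).
Implicit Types x y z : circle R.

Lemma circle_eqn x : (val x).1 ^+ 2 + (val x).2 ^+ 2 = 1.
Proof. exact: (set_mem (valP x)). Qed.

Lemma circle_eq x y : (val x).1 = (val y).1 -> (val x).2 = (val y).2 -> x = y.
Proof.
move=> h1 h2; apply: val_inj.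
by rewrite [LHS]surjective_pairing [RHS]surjective_pairing h1 h2.
Qed.

Lemma rotate0 x : rotate 0 x = x.
Proof. by apply: circle_eq; rewrite /= cos0 sin0; ring. Qed.

Definition circle_dot x y : R :=
  (val x).1 * (val y).1 + (val x).2 * (val y).2.

Definition circle_cross x y : R :=
  (val x).1 * (val y).2 - (val x).2 * (val y).1.

Lemma circle_dotxx x : circle_dot x x = 1.
Proof. by rewrite /circle_dot -!expr2 circle_eqn. Qed.

Lemma circle_crossxx x : circle_cross x x = 0.
Proof. by rewrite /circle_cross mulrC subrr. Qed.

Lemma circle_dot_cross x y : circle_dot x y ^+ 2 + circle_cross x y ^+ 2 = 1.
Proof.
transitivity (((val x).1 ^+ 2 + (val x).2 ^+ 2) *
              ((val y).1 ^+ 2 + (val y).2 ^+ 2)).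
  by rewrite /circle_dot /circle_cross; ring.
by rewrite !circle_eqn mulr1.
Qed.

(** This is the signed angle from [x] to [y] as long as they are less than a quarter turn apart,
    that is, when [circle_dot x y] is positive: [asin] takes its values between [- pi / 2] and
    [pi / 2]. *)
Definition circle_angle x y : R := asin (circle_cross x y).

Lemma circle_angle_xx x : circle_angle x x = 0.
Proof.
rewrite /circle_angle circle_crossxx -[X in asin X]sin0 sinK//.
by rewrite in_itv/= oppr_le0 divr_ge0// pi_ge0.
Qed.

Lemma circle_cross_itv x y : -1 <= circle_cross x y <= 1.
Proof.
have h := circle_dot_cross x y; have := sqr_ge0 (circle_dot x y).
by move=> ?; apply/andP; split; nra.
Qed.

Lemma rotate_angle y z : 0 < circle_dot y z -> rotate (circle_angle y z) y = z.
Proof.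
move=> dyz0; have c_itv := circle_cross_itv y z.
have sE : sin (circle_angle y z) = circle_cross y z by rewrite asinK.
have cE : cos (circle_angle y z) = circle_dot y z.
  rewrite cos_asin// -(circle_dot_cross y z) addrK sqrtr_sqr.
  by rewrite gtr0_norm.
apply: circle_eq; rewrite /= sE cE /circle_dot /circle_cross.
  transitivity ((val z).1 * ((val y).1 ^+ 2 + (val y).2 ^+ 2)); first by ring.
  by rewrite circle_eqn mulr1.
transitivity ((val z).2 * ((val y).1 ^+ 2 + (val y).2 ^+ 2)); first by ring.
by rewrite circle_eqn mulr1.
Qed.

Lemma continuous_circle_val : continuous (val : circle R -> R * R).
Proof. exact: (@initial_continuous (circle R) (R * R)%type val). Qed.

Lemma continuous_circle1 : continuous (fun x => (val x).1).
Proof.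
move=> x; apply: (@continuous_comp _ _ _ (val : circle R -> _) fst).
  exact: continuous_circle_val.
exact: cvg_fst.
Qed.

Lemma continuous_circle2 : continuous (fun x => (val x).2).
Proof.
move=> x; apply: (@continuous_comp _ _ _ (val : circle R -> _) snd).
  exact: continuous_circle_val.
exact: cvg_snd.
Qed.

Lemma continuous_to_circle (V : topologicalType) (h : V -> circle R) :
  continuous (fun v => (val (h v)).1) -> continuous (fun v => (val (h v)).2) ->
  continuous h.
Proof.
move=> h1 h2.
apply: (@continuous_comp_initial (circle R) V (R * R)%type val) => v.
have -> : (val : circle R -> R * R) \o h =
    fun v => ((val (h v)).1, (val (h v)).2).
  by apply/funext => w; rewrite /= -surjective_pairing.
exact: cvg_pair (h1 v) (h2 v).
Qed.

Lemma continuous_rotate_time x : continuous (fun t : R => rotate t x).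
Proof.
apply: continuous_to_circle => t /=.
  apply: cvgB; apply: cvgM; try exact: cvg_cst.
    exact: continuous_cos.
  exact: continuous_sin.
apply: cvgD; apply: cvgM; try exact: cvg_cst.
  exact: continuous_sin.
exact: continuous_cos.
Qed.

Lemma continuous_circle_linear (a b : R) :
  continuous (fun x => (val x).1 * a + (val x).2 * b).
Proof.
apply: continuous_add; apply: continuous_mul; try exact: continuous_const.
  exact: continuous_circle1.
exact: continuous_circle2.
Qed.

Lemma continuous_rotate (t : R) : continuous (rotate t).
Proof.
apply: continuous_to_circle => /=; last exact: continuous_circle_linear.
under eq_fun do rewrite -mulrN.
exact: continuous_circle_linear.
Qed.

Lemma continuous_circle_dot x : continuous (circle_dot x).
Proof.
rewrite /circle_dot; under eq_fun do rewrite (mulrC (val x).1) (mulrC (val x).2).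
exact: continuous_circle_linear.
Qed.

Lemma continuous_circle_cross x : continuous (circle_cross x).
Proof.
rewrite /circle_cross.
under eq_fun do rewrite addrC -mulNr (mulrC (- (val x).2)) (mulrC (val x).1).
exact: continuous_circle_linear.
Qed.

Lemma near_circle_dot_gt0 x : \forall y \near x, 0 < circle_dot x y.
Proof.
apply: near_continuous_gt; first exact: continuous_circle_dot.
by rewrite circle_dotxx.
Qed.

Lemma cvg_circle_angle x : circle_angle x y @[y --> x] --> (0 : R).
Proof.
rewrite -[X in _ --> X](circle_angle_xx x).
apply: (@continuous_comp _ _ _ (circle_cross x) asin).
  exact: continuous_circle_cross.
by apply: continuous_asin; rewrite circle_crossxx ltrN10 ltr01.
Qed.

(** Near [x] the arc [t |-> rotate t x] has the continuous inverse [circle_angle x], so a limit at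
    [x] can be computed along the arc. Questions of continuity on the circle thus reduce to a real
    parameter at 0. *)
Lemma circle_continuousP (V : topologicalType) (h : circle R -> V) x :
  {for x, continuous h} <-> h (rotate t x) @[t --> (0 : R)] --> h x.
Proof.
split=> [ch|ch].
  have ch0 : h y @[y --> rotate 0 x] --> h x by rewrite rotate0.
  exact: (cvg_comp _ _ (@continuous_rotate_time x 0) ch0).
have near_h : \forall y \near x, h (rotate (circle_angle x y) x) = h y.
  by apply: filterS (near_circle_dot_gt0 x) => y /rotate_angle ->.
have : h (rotate (circle_angle x y) x) @[y --> x] --> h x.
  exact: (cvg_comp _ _ (@cvg_circle_angle x) ch).
by apply: cvg_trans; exact: near_eq_cvg near_h.
Qed.

End circle_geometry.

(** * Derivatives of circle maps and the chain rule *)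

Section circle_derivative.
Context (R : realType).
Implicit Types (g f : circle R -> circle R) (x : circle R).

Lemma circle_C1_continuous g : circle_C1 g -> continuous g.
Proof.
move=> [dg _] x; apply/circle_continuousP.
have [/derivable1_diffP/differentiable_continuous d1
      /derivable1_diffP/differentiable_continuous d2] := dg x.
pose k (t : R) := val (g (rotate t x)).
have ck : k t @[t --> (0:R)] --> k 0.
  have -> : k = fun t => (circle_arc1 g x t, circle_arc2 g x t).
    by apply/funext => t; rewrite /k /circle_arc1 /circle_arc2 -surjective_pairing.
  exact: (cvg_pair d1 d2).
(* The topology of the circle is induced by the plane, so convergence of the two coordinates is
   enough. *)
move=> U [_ [[W oW <-] /= Wgx WU]].
have Wk0 : W (k 0) by rewrite /k rotate0.
have : nbhs (k 0) W := open_nbhs_nbhs (conj oW Wk0).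
move=> /ck Wk.
have {}Wk : \forall t \near (0 : R), W (k t) by [].
have : \forall t \near (0 : R), U (g (rotate t x)).
  by near=> t; apply: WU; near: t.
by [].
Unshelve. all: by end_near. Qed.

(* Near [0], [g (rotate t x) = rotate (theta t) (g x)] with
   [theta t = circle_angle (g x) (g (rotate t x))], and
   [theta' 0 = circle_deriv g x]. *)
Lemma circle_deriv_comp f g x : circle_C1 g -> circle_C1 f ->
  [/\ derivable (circle_arc1 (f \o g) x) 0 1,
      derivable (circle_arc2 (f \o g) x) 0 1 &
      circle_deriv (f \o g) x = circle_deriv f (g x) * circle_deriv g x].
Proof.
move=> C1g C1f; have cg := circle_C1_continuous C1g.
pose theta (t : R) := circle_angle (g x) (g (rotate t x)).
have theta0 : theta 0 = 0 by rewrite /theta rotate0 circle_angle_xx.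
have near_theta : \forall t \near (0 : R),
    g (rotate t x) = rotate (theta t) (g x).
  have cgr : g (rotate t x) @[t --> (0 : R)] --> g x.
    by apply/circle_continuousP; exact: cg.
  have gdot : \forall t \near (0 : R), 0 < circle_dot (g x) (g (rotate t x)).
    exact: cgr _ (near_circle_dot_gt0 (g x)).
  by near=> t; rewrite /theta rotate_angle//; near: t.
have [d1 d2] := C1g.1 x.
have dtheta : is_derive (0:R) (1:R) theta (circle_deriv g x).
  have id1 : is_derive (0:R) (1:R) (circle_arc1 g x) (derive1 (circle_arc1 g x) 0).
    by rewrite derive1E; exact: derivableP d1.
  have id2 : is_derive (0:R) (1:R) (circle_arc2 g x) (derive1 (circle_arc2 g x) 0).
    by rewrite derive1E; exact/derivableP.
  (* [cr t] is the cross product of [g x] with [g (rotate t x)], so [theta = asin \o cr]. Its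
     derivative at 0 is [circle_deriv g x] by definition, and [asin] has slope 1 at [cr 0 = 0]. *)
  pose cr := (val (g x)).1 *: circle_arc2 g x - (val (g x)).2 *: circle_arc1 g x.
  have dcr : is_derive (0:R) (1:R) cr (circle_deriv g x).
    exact: is_deriveB.
  have cr0 : cr 0 = 0.
    rewrite /cr /circle_arc1 /circle_arc2 !fctE rotate0.
    exact: circle_crossxx.
  have das : is_derive (cr 0) (1:R) (@asin R) 1.
    rewrite cr0; apply: is_derive_eq.
      by apply: is_derive1_asin; rewrite ltrN10 ltr01.
    by rewrite expr0n/= subr0 sqrtr1 invr1.
  have -> : theta = @asin R \o cr by apply/funext => t.
  by apply: is_derive_eq; rewrite mul1r.
(* Both coordinates are treated at once: the two equations on [arc] express that it depends only on
   the point [h (rotate t y)]. *)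
have dcomp (arc : (circle R -> circle R) -> circle R -> R -> R) :
    (forall h y t, arc h y t = arc h (rotate t y) 0) ->
    (forall h k y, arc (h \o k) y 0 = arc h (k y) 0) ->
    derivable (arc f (g x)) 0 1 ->
    is_derive (0:R) (1:R) (arc (f \o g) x)
      (derive1 (arc f (g x)) 0 * circle_deriv g x).
  move=> arcE arc_comp darc.
  have darc' : is_derive (theta 0) (1:R) (arc f (g x)) (derive1 (arc f (g x)) 0).
    by rewrite theta0 derive1E; exact/derivableP.
  have dac : is_derive (0:R) (1:R) (arc f (g x) \o theta)
      (derive1 (arc f (g x)) 0 * circle_deriv g x).
    exact: is_derive1_comp.
  apply: near_eq_is_derive dac; apply: filterS near_theta => t gt /=.
  by rewrite (arcE (f \o g)) arc_comp gt -arcE.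
have [e1 e2] := C1f.1 (g x).
have D1 := dcomp (@circle_arc1 R) _ _ e1.
have D2 := dcomp (@circle_arc2 R) _ _ e2.
have {}D1 : is_derive (0:R) (1:R) (circle_arc1 (f \o g) x)
      (derive1 (circle_arc1 f (g x)) 0 * circle_deriv g x).
  by apply: D1 => *; rewrite /circle_arc1/= !rotate0.
have {}D2 : is_derive (0:R) (1:R) (circle_arc2 (f \o g) x)
      (derive1 (circle_arc2 f (g x)) 0 * circle_deriv g x).
  by apply: D2 => *; rewrite /circle_arc2/= !rotate0.
split; [exact: ex_derive|exact: ex_derive|].
by rewrite {1}/circle_deriv !derive1E !derive_val /circle_deriv/= !mulrA -mulrBl.
Unshelve. all: by end_near. Qed.

Lemma circle_C1_comp f g : circle_C1 f -> circle_C1 g -> circle_C1 (f \o g).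
Proof.
move=> C1f C1g; split=> [x|]; first by have [] := circle_deriv_comp x C1g C1f.
have -> : circle_deriv (f \o g) = fun x => circle_deriv f (g x) * circle_deriv g x.
  by apply/funext => x; have [] := circle_deriv_comp x C1g C1f.
apply: continuous_mul; last exact: C1g.2.
move=> x.
have c1 : g y @[y --> x] --> g x by exact: circle_C1_continuous.
have c2 : circle_deriv f y @[y --> g x] --> circle_deriv f (g x) by exact: C1f.2.
exact: (cvg_comp _ _ c1 c2).
Qed.

Lemma circle_deriv_id_C1 : circle_C1 (@id (circle R)) /\
  forall x, circle_deriv (@id (circle R)) x = 1.
Proof.
have D x : is_derive (0:R) (1:R) (circle_arc1 id x) (- (val x).2) /\
           is_derive (0:R) (1:R) (circle_arc2 id x) (val x).1.
  split.
    have -> : circle_arc1 id x = (val x).1 *: cos - (val x).2 *: sin by [].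
    apply: is_derive_eq; rewrite sin0 cos0 oppr0 scaler0 sub0r.
    by rewrite /GRing.scale/= mulr1.
  have -> : circle_arc2 id x = (val x).1 *: sin - (- (val x).2) *: cos.
    by rewrite scaleNr opprK.
  apply: is_derive_eq; rewrite sin0 cos0 oppr0 scaler0 subr0.
  by rewrite /GRing.scale/= mulr1.
have dE x : circle_deriv (@id (circle R)) x = 1.
  have [? ?] := D x.
  rewrite /circle_deriv !derive1E !derive_val/= mulrN opprK -!expr2.
  exact: circle_eqn.
split=> //; split=> [x|].
  by have [? ?] := D x; split; exact: ex_derive.
rewrite (_ : circle_deriv id = cst 1); last exact/funext.
exact: continuous_const.
Qed.

Lemma circle_C1_id : circle_C1 (@id (circle R)).
Proof. exact: circle_deriv_id_C1.1. Qed.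

Lemma circle_deriv_id x : circle_deriv (@id (circle R)) x = 1.
Proof. exact: circle_deriv_id_C1.2. Qed.

Lemma circle_C1_diffeo_id : circle_C1_diffeo (@id (circle R)).
Proof.
by split; [|exists id; split=> //]; exact: circle_C1_id.
Qed.

(** By the chain rule for [h \o g = id], the derivative of [g] is a factor of 1. *)
Lemma circle_C1_diffeo_deriv_neq0 g x :
  circle_C1_diffeo g -> circle_deriv g x != 0.
Proof.
move=> [C1g [h [gK _ C1h]]]; have [_ _] := circle_deriv_comp x C1g C1h.
rewrite (_ : h \o g = id); last by apply/funext => y; exact: gK.
by rewrite circle_deriv_id; apply: contra_eq_neq => ->; rewrite mulr0 oner_neq0.
Qed.

End circle_derivative.

(** * Topology and Borel sets of the circle *)

Section circle_topology.
Context (R : realType).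
Implicit Types (x y z : circle R) (U : set (circle R)).

(** The angle is [acos] of the first coordinate, with the sign of the second one. The bounded range
    of angles is what yields compactness of the circle. *)
Lemma circle_polar z : exists2 t, -pi <= t <= pi & z = rotate t (point : circle R).
Proof.
have z_itv : -1 <= (val z).1 <= 1.
  have := circle_eqn z; have := sqr_ge0 (val z).2.
  by move=> *; apply/andP; split; nra.
have cE : cos (acos (val z).1) = (val z).1 by rewrite acosK.
have sE : sin (acos (val z).1) = `|(val z).2|.
  by rewrite sin_acos// -(circle_eqn z) addrC addKr sqrtr_sqr.
have a0 : 0 <= acos (val z).1 by rewrite acos_ge0.
have api : acos (val z).1 <= pi by rewrite acos_lepi.
have := pi_ge0 R => pi0.
have [z2|z2] := leP 0 (val z).2.
  exists (acos (val z).1); first by apply/andP; split; lra.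
  by apply: circle_eq; rewrite /= cE sE ger0_norm// !mul0r !mul1r ?subr0 ?addr0.
exists (- acos (val z).1); first by apply/andP; split; lra.
apply: circle_eq; rewrite /= cosN sinN cE sE ltr0_norm// opprK.
  by rewrite !mul0r !mul1r subr0.
by rewrite !mul0r !mul1r addr0.
Qed.

Lemma circle_compact : compact [set: circle R].
Proof.
have -> : [set: circle R] = (fun t : R => rotate t point) @` `[-pi, pi].
  apply/seteqP; split=> // z _; have [t tpi ->] := circle_polar z.
  by exists t => //=; rewrite in_itv.
apply: continuous_compact; last exact: segment_compact.
apply: continuous_subspaceT; exact: continuous_rotate_time.
Qed.

(** The largest index of a finite subcover works everywhere. This form of compactness gives bounds
    for continuous functions and, as in Dini's theorem, makes monotone approximations uniform. *)
Lemma circle_increasing_cover (O : (set (circle R))^nat) :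
  (forall n, open (O n)) -> (forall m n, (m <= n)%N -> O m `<=` O n) ->
  (forall x, exists n, O n x) -> exists n, forall x, O n x.
Proof.
move=> oO ndO covO; have := circle_compact; rewrite compact_cover.
move=> /(_ nat setT O (fun i _ => oO i))[x _|D _ cD].
  by have [n Onx] := covO x; exists n.
exists (\max_(i <- finmap.enum_fset D) i)%N => x.
have [i /= iD Oix] := cD x I.
by apply: ndO Oix; exact: leq_bigmax_seq.
Qed.

Lemma circle_continuous_bounded (h : circle R -> R) : continuous h ->
  exists2 M, 0 <= M & forall x, `|h x| <= M.
Proof.
move=> ch; have [||x|n hn] :=
    @circle_increasing_cover (fun n => [set x | - n%:R < - `|h x|]).
- move=> n; apply: open_gt_continuous; apply: continuous_opp.
  exact: continuous_normr.
- move=> m n mn x /=; rewrite !ltrN2 => /lt_le_trans; apply.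
  by rewrite ler_nat.
- exists (Num.truncn `|h x|).+1 => /=; rewrite ltrN2.
  by rewrite truncnS_gt.
- exists n%:R => // x; have /= := hn x.
  by rewrite ltrN2 => /ltW.
Qed.

(** The l1 distance of the plane; [near_circle_dist] and [open_circle_dist] show that it induces the
    topology of the circle. *)
Definition circle_dist x y : R :=
  `|(val x).1 - (val y).1| + `|(val x).2 - (val y).2|.

Lemma circle_dist_ge0 x y : 0 <= circle_dist x y.
Proof. exact: addr_ge0. Qed.

Lemma circle_distxx x : circle_dist x x = 0.
Proof. by rewrite /circle_dist !subrr normr0 addr0. Qed.

Lemma circle_distC x y : circle_dist x y = circle_dist y x.
Proof. by rewrite /circle_dist distrC (distrC (val x).2). Qed.

Lemma circle_dist_triangle y x z :
  circle_dist x z <= circle_dist x y + circle_dist y z.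
Proof. by rewrite /circle_dist addrACA lerD// ler_distD. Qed.

Lemma continuous_circle_dist x : continuous (circle_dist x).
Proof.
apply: continuous_add; apply: continuous_normr; apply: continuous_sub;
  try exact: continuous_const.
  exact: continuous_circle1.
exact: continuous_circle2.
Qed.

Lemma near_circle_dist x e : 0 < e -> \forall y \near x, circle_dist x y < e.
Proof.
move=> e0.
have h : \forall y \near x, - e < - circle_dist x y.
  apply: near_continuous_gt; last by rewrite circle_distxx ltrN2.
  by apply: continuous_opp; exact: continuous_circle_dist.
by apply: filterS h => y; rewrite ltrN2.
Qed.

Lemma open_circle_dist U x : open U -> U x ->
  exists2 e, 0 < e & forall y, circle_dist x y < e -> U y.
Proof.
move=> [W oW <-] Wx.
have /nbhs_ballP[e /= e0 eW] : nbhs (val x) W := open_nbhs_nbhs (conj oW Wx).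
exists e => // y xye; apply: eW; split => /=; apply: le_lt_trans xye.
  by rewrite /circle_dist lerDl.
by rewrite /circle_dist lerDr.
Qed.

(* Including [1] keeps the infimum over a nonempty set when [U = setT]. *)
Definition codist U x : R :=
  inf [set r | r = 1 \/ exists2 y, ~ U y & r = circle_dist x y].

Let codist_set U x := [set r | r = 1 \/ exists2 y, ~ U y & r = circle_dist x y].

Let codist_set_lb U x : lbound (codist_set U x) 0.
Proof. by move=> _ [->//|[y _ ->]]; exact: circle_dist_ge0. Qed.

Let codist_set_neq0 U x : codist_set U x !=set0.
Proof. by exists 1; left. Qed.

Let ge_codist U x : lbound (codist_set U x) (codist U x).
Proof. by apply: ge_inf; exists 0; exact: codist_set_lb. Qed.

Lemma codist_ge0 U x : 0 <= codist U x.
Proof. exact: lb_le_inf (@codist_set_neq0 U x) (@codist_set_lb U x). Qed.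

Lemma codist_out U x : ~ U x -> codist U x = 0.
Proof.
move=> Ux; apply/eqP; rewrite eq_le codist_ge0 andbT.
by apply: ge_codist; right; exists x => //; rewrite circle_distxx.
Qed.

Lemma codist_gt0 U x : open U -> U x -> 0 < codist U x.
Proof.
move=> oU Ux; have [e e0 eU] := open_circle_dist oU Ux.
suff : Num.min e 1 <= codist U x.
  by apply: lt_le_trans; rewrite lt_min e0 ltr01.
apply: lb_le_inf; first exact: codist_set_neq0.
move=> _ [->|[y Uy ->]]; first by rewrite ge_min lexx orbT.
by rewrite ge_min leNgt; apply/orP; left; apply/negP => /eU.
Qed.

(** [codist U] is an infimum of 1-Lipschitz functions: the constant 1 and the distances to the
    points outside [U]. *)
Lemma codist_lipschitz U x y : codist U x - codist U y <= circle_dist x y.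
Proof.
rewrite lerBlDr -lerBlDl; apply: lb_le_inf; first exact: codist_set_neq0.
move=> _ [->|[z Uz ->]].
  rewrite lerBlDl; apply: (@le_trans _ _ 1); first by apply: ge_codist; left.
  by rewrite lerDr circle_dist_ge0.
rewrite lerBlDl; apply: le_trans (circle_dist_triangle y x z).
by apply: ge_codist; right; exists z.
Qed.

Lemma continuous_codist U : continuous (codist U).
Proof.
apply: continuous_nearP => x e e0.
have hh : forall y, circle_dist x y < e -> `|codist U x - codist U y| < e.
  move=> y; apply: le_lt_trans; rewrite ler_norml codist_lipschitz andbT.
  by rewrite lerNl opprB circle_distC codist_lipschitz.
exact: filterS hh (near_circle_dist x e0).
Qed.

(** Urysohn functions: they vanish outside [U] and, for open [U], increase with [n] to its
    indicator. They connect integrals of continuous functions with measures of open sets. *)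
Definition bump U (n : nat) x : R := Num.min 1 (n%:R * codist U x).

Lemma continuous_bump U n : continuous (bump U n).
Proof.
apply: continuous_minr; first exact: continuous_const.
by apply: continuous_mul; [exact: continuous_const|exact: continuous_codist].
Qed.

Lemma bump_ge0 U n x : 0 <= bump U n x.
Proof. by rewrite le_min ler01/= mulr_ge0// codist_ge0. Qed.

Lemma bump_le1 U n x : bump U n x <= 1.
Proof. by rewrite ge_min lexx. Qed.

Lemma bump_out U n x : ~ U x -> bump U n x = 0.
Proof.
by move=> /codist_out; rewrite /bump => ->; rewrite mulr0 min_r ?ler01.
Qed.

Lemma bump_le U m n x : (m <= n)%N -> bump U m x <= bump U n x.
Proof.
move=> mn; rewrite /bump le_min ge_min lexx/= ge_min.
by rewrite ler_wpM2r ?orbT ?codist_ge0// ler_nat.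
Qed.

Lemma bump_eq1 U n x : 1 <= n%:R * codist U x -> bump U n x = 1.
Proof. by move=> h; rewrite /bump min_l. Qed.

Lemma bump_eventually1 U x : open U -> U x -> exists n, bump U n x = 1.
Proof.
move=> oU Ux; have d0 := codist_gt0 oU Ux.
exists (Num.truncn (codist U x)^-1).+1; apply: bump_eq1.
by rewrite -ler_pdivrMr// div1r ltW// truncnS_gt.
Qed.

Lemma cvg_bump U x : open U -> bump U n x @[n --> \oo] --> (\1_U x : R).
Proof.
move=> oU; rewrite indicE; have [/set_mem Ux|/negP Ux] := boolP (x \in U).
  have [n hn] := bump_eventually1 oU Ux.
  apply: cvg_near_cst; exists n => // m /= nm; apply/eqP.
  by rewrite eq_le bump_le1/= -hn bump_le.
apply: cvg_near_cst; apply: nearW => n; apply: bump_out.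
by move=> /mem_set.
Qed.

End circle_topology.

(** * Borel measurability on the circle *)

Section circle_measurability.
Context (R : realType).

Lemma circle_open_measurable (U : set (circle R)) : open U -> measurable U.
Proof. by move=> oU; apply: sub_sigma_algebra. Qed.

Lemma circle_continuous_measurable (h : circle R -> R) :
  continuous h -> measurable_fun [set: circle R] h.
Proof.
move=> /continuousP ch; apply: (measurability _ (RGenOpens.measurableE R)).
move=> _ [_ [a [b ->] <-]]; rewrite setTI; apply: circle_open_measurable.
exact/ch/interval_open.
Qed.

Lemma measurable_fun_to_circle d (T : measurableType d) (h : T -> circle R) :
  (forall U : set (circle R), open U -> measurable (h @^-1` U)) ->
  measurable_fun setT h.
Proof.
move=> hU; apply: (@measurability _ _ T (circle R) setT h (@open (circle R))).
  by [].
by move=> _ [U oU <-]; rewrite setTI; exact: hU.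
Qed.

Lemma continuous_circle_measurable (h : circle R -> circle R) :
  continuous h -> measurable_fun setT h.
Proof.
move=> /continuousP ch; apply: measurable_fun_to_circle => U oU.
by apply: circle_open_measurable; exact: ch.
Qed.

Lemma cvg_integral_bump (mu : {measure set (circle R) -> \bar R})
    (U : set (circle R)) : open U ->
  (\int[mu]_x (bump U n x)%:E @[n --> \oo] --> mu U)%E.
Proof.
move=> oU.
have <- : (\int[mu]_x (\1_U x)%:E)%E = mu U.
  by rewrite integral_indic// ?setIT//; exact: circle_open_measurable.
rewrite (_ : (\int[mu]_x (\1_U x)%:E)%E =
             (\int[mu]_x limn (fun n => (bump U n x)%:E))%E); last first.
  apply: eq_integral => x _; apply/esym/cvg_lim => //.
  by apply: cvg_EFin; [exact: nearW|exact: cvg_bump].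
apply: (@cvg_monotone_convergence _ _ R mu setT measurableT
         (fun n x => (bump U n x)%:E)).
- move=> n; apply/measurable_EFinP; apply: circle_continuous_measurable.
  exact: continuous_bump.
- by move=> n x _; rewrite lee_fin bump_ge0.
- by move=> x _ m n mn; rewrite lee_fin bump_le.
Qed.

(** The measure of an open set is the limit of the integrals of its bumps, and the open sets are a
    generating family closed under intersection. *)
Lemma circle_probability_eq (mu nu : probability (circle R) R) :
  (forall h : circle R -> R, continuous h -> (forall x, 0 <= h x <= 1) ->
    (\int[mu]_x (h x)%:E = \int[nu]_x (h x)%:E)%E) ->
  forall A, measurable A -> mu A = nu A.
Proof.
move=> h A mA.
apply: (@measure_unique _ R (circle R) (@open (circle R)) (fun _ => setT)) => //.
- by move=> U V oU oV; exact: openI.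
- by move=> _; exact: openT.
- by rewrite bigcup_const//; exists 0%N.
- move=> U oU; apply: (cvg_unique _ (cvg_integral_bump (mu:=mu) oU)) => //.
  have := cvg_integral_bump (mu:=nu) oU; apply: cvg_trans.
  apply: near_eq_cvg; apply: nearW => n; apply/esym; apply: h.
    exact: continuous_bump.
  by move=> x; rewrite bump_ge0 bump_le1.
- by move=> _ /=; apply: le_lt_trans (ltry 1); rewrite -(@probability_setT _ _ _ mu).
Qed.

End circle_measurability.

(** * The Riesz representation theorem on the circle *)

Section probability_integral.
Context d (T : measurableType d) (R : realType) (m : probability T R).
Implicit Types f g : T -> R.

Lemma bounded_integrable f M : measurable_fun setT f ->
  (forall x, `|f x| <= M) -> m.-integrable setT (EFin \o f).
Proof.
move=> mf fM; apply: measurable_bounded_integrable => //.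
  by apply: le_lt_trans (ltry 1); rewrite -(@probability_setT _ _ _ m).
exists M; split; first exact: num_real.
by move=> N MN x _ /=; apply: le_trans (fM x) (ltW MN).
Qed.

Lemma Rintegral_prob_cst (r : R) : \int[m]_x r = r.
Proof.
rewrite Rintegral_cst// [X in fine X](_ : _ = 1%E) ?mulr1//.
exact: probability_setT.
Qed.

Lemma integrable_prob_cst (r : R) : m.-integrable setT (EFin \o (fun _ => r)).
Proof. by apply: (@bounded_integrable _ `|r|). Qed.

Lemma le_Rintegral_prob f g :
  m.-integrable setT (EFin \o f) -> m.-integrable setT (EFin \o g) ->
  (forall x, f x <= g x) -> \int[m]_x f x <= \int[m]_x g x.
Proof. by move=> mf mg fg; apply: le_Rintegral. Qed.

Lemma Rintegral_prob_bound f M : m.-integrable setT (EFin \o f) ->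
  (forall x, `|f x| <= M) -> `|\int[m]_x f x| <= M.
Proof.
move=> mf fM; apply: le_trans (le_normr_Rintegral measurableT mf) _.
rewrite -[leRHS]Rintegral_prob_cst; apply: le_Rintegral_prob => //.
  exact: integrable_norm.
exact: integrable_prob_cst.
Qed.

End probability_integral.

Section circle_integral.
Context (R : realType) (mu : probability (circle R) R).

Lemma circle_continuous_integrable (h : circle R -> R) : continuous h ->
  mu.-integrable setT (EFin \o h).
Proof.
move=> ch; have [M _ hM] := circle_continuous_bounded ch.
apply: bounded_integrable hM; exact: circle_continuous_measurable.
Qed.

End circle_integral.

(* The values of [L] at discontinuous functions are irrelevant. *)
Record positive_functional (R : realType) (L : (circle R -> R) -> R) : Prop := {
  functional_add : forall f g : circle R -> R, continuous f -> continuous g ->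
    L (fun x => f x + g x) = L f + L g ;
  functional_scale : forall (c : R) (f : circle R -> R), continuous f -> L (fun x => c * f x) = c * L f ;
  functional_ge0 : forall f : circle R -> R, continuous f -> (forall x, 0 <= f x) -> 0 <= L f ;
  functional_1 : L (fun _ => 1) = 1 }.

Section riesz.
Context (R : realType) (L : (circle R -> R) -> R).
Hypothesis pL : positive_functional L.
Implicit Types (f g h : circle R -> R) (U V : set (circle R)).

Lemma functional_cst (c : R) : L (fun _ => c) = c.
Proof.
transitivity (c * L (fun _ => 1)); last by rewrite (functional_1 pL) mulr1.
rewrite -(functional_scale pL); last exact: continuous_const.
by congr L; apply/funext => x; rewrite mulr1.
Qed.

Lemma functional_sub f g : continuous f -> continuous g ->
  L (fun x => f x - g x) = L f - L g.
Proof.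
move=> cf cg.
rewrite -[in RHS]mulN1r -(functional_scale pL)// -(functional_add pL)//.
  by congr L; apply/funext => x; rewrite mulN1r.
by apply: continuous_mul => //; exact: continuous_const.
Qed.

Lemma le_functional f g : continuous f -> continuous g ->
  (forall x, f x <= g x) -> L f <= L g.
Proof.
move=> cf cg fg; rewrite -subr_ge0 -functional_sub//.
apply: (functional_ge0 pL); first exact: continuous_sub.
by move=> x; rewrite subr_ge0.
Qed.

Lemma functional_sum n (f : nat -> circle R -> R) : (forall i, continuous (f i)) ->
  L (fun x => \sum_(i < n) f i x) = \sum_(i < n) L (f i).
Proof.
move=> cf; elim: n => [|n ih].
  by under eq_fun do rewrite big_ord0; rewrite functional_cst big_ord0.
under eq_fun do rewrite big_ord_recr/=.
by rewrite (functional_add pL) ?ih ?big_ord_recr//; exact: continuous_sumr.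
Qed.

(** The test functions in the supremum defining the measure of an open set. They vanish outside [U]
    instead of having compact support in [U]; the margin [e] in [omega_bigcup] and
    [open_caratheodory] absorbs the difference. *)
Let subindic U := [set h : circle R -> R | [/\ continuous h, forall x, 0 <= h x,
  forall x, h x <= 1 & forall x, ~ U x -> h x = 0]].

Let subindic0 U : subindic U (fun _ => 0).
Proof. by split=> //; exact: continuous_const. Qed.

Let omega U : R := sup [set L h | h in subindic U].

Let omega_ub U : has_ubound [set L h | h in subindic U].
Proof.
exists 1 => _ [h [ch _ h1 _] <-]; rewrite -(functional_cst 1).
by apply: le_functional => //; exact: continuous_const.
Qed.

Let omega_ge U h : subindic U h -> L h <= omega U.
Proof. by move=> hU; apply: ub_le_sup => //; exists h. Qed.

Let omega_le U c : (forall h, subindic U h -> L h <= c) -> omega U <= c.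
Proof.
move=> hc; apply: ge_sup; first by exists (L (fun _ => 0)); exists (fun _ => 0).
by move=> _ [h hU <-]; exact: hc.
Qed.

Let omega_ge0 U : 0 <= omega U.
Proof. by rewrite -(functional_cst 0); exact: omega_ge. Qed.

Let omega_le1 U : omega U <= 1.
Proof.
apply: omega_le => h [ch _ h1 _]; rewrite -(functional_cst 1).
by apply: le_functional => //; exact: continuous_const.
Qed.

Let le_omega U V : U `<=` V -> omega U <= omega V.
Proof.
move=> UV; apply: omega_le => h [ch h0 h1 hU]; apply: omega_ge.
by split=> // x Vx; apply: hU => /UV.
Qed.

Let omegaT : omega setT = 1.
Proof.
apply/eqP; rewrite eq_le omega_le1/= -{1}(functional_cst 1).
apply: omega_ge; split=> [|x|x|x []] //; exact: continuous_const.
Qed.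

Let bump_subindic U n : subindic U (bump U n).
Proof.
split; [exact: continuous_bump|exact: bump_ge0|exact: bump_le1|exact: bump_out].
Qed.

(** Every point of the union lies in some [U i], whose bump is eventually 1 there. So the sum of the
    first [n] bumps eventually exceeds [h - e] at each point, hence for one [n] at all points by
    compactness; [L] is then applied to a finite sum. *)
Let omega_bigcup (U : (set (circle R))^nat) : (forall i, open (U i)) ->
  ((omega (\bigcup_i U i))%:E <= \sum_(i <oo) (omega (U i))%:E)%E.
Proof.
move=> oU.
suff key h e : 0 < e -> subindic (\bigcup_i U i) h ->
    ((L h)%:E <= \sum_(i <oo) (omega (U i))%:E + e%:E)%E.
  apply/lee_addgt0Pr => e e0.
  have [->|fin] := eqVneq (\sum_(i <oo) (omega (U i))%:E)%E +oo%E.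
    by rewrite addye// leey.
  have fE : (\sum_(i <oo) (omega (U i))%:E)%E \is a fin_num.
    rewrite ge0_fin_numE ?ltey//; apply: nneseries_ge0 => i _ _.
    by rewrite lee_fin.
  rewrite -(fineK fE) -EFinD lee_fin; apply: omega_le => h hU.
  by rewrite -lee_fin EFinD fineK//; exact: key.
move=> e0 [ch h0 h1 hU].
pose s n x := \sum_(i < n) bump (U i) n x.
have cs n : continuous (s n).
  by apply: (@continuous_sumr _ _ n (fun i => bump (U i) n)) => i;
    exact: continuous_bump.
have [||x|n hn] := @circle_increasing_cover R
    (fun n => [set x | - e < s n x - h x]).
- by move=> n; apply: open_gt_continuous; exact: continuous_sub.
- move=> m n mn x /= /lt_le_trans; apply; rewrite lerD2r /s.
  apply: (@le_trans _ _ (\sum_(i < m) bump (U i) n x)).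
    by apply: ler_sum => i _; exact: bump_le.
  rewrite (big_ord_widen n (fun i => bump (U i) n x))// big_mkcond/=.
  by apply: ler_sum => i _; case: ifP => // _; exact: bump_ge0.
- have [[i _ Uix]|Ux] := pselect ((\bigcup_i U i) x).
    have [k hk] := bump_eventually1 (oU i) Uix.
    (* The index must be larger than [i] for [U i] to enter the sum, and at least [k] for its bump
       to be 1 at [x]. *)
    exists (maxn k i.+1); rewrite /= /s.
    have im : (i < maxn k i.+1)%N by rewrite leq_max ltnSn orbT.
    rewrite (bigD1 (Ordinal im))//=.
    have -> : bump (U i) (maxn k i.+1) x = 1.
      by apply/eqP; rewrite eq_le bump_le1/= -hk bump_le// leq_maxl.
    have : 0 <= \sum_(j < maxn k i.+1 | j != Ordinal im) bump (U j) (maxn k i.+1) x.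
      by apply: sumr_ge0 => j _; exact: bump_ge0.
    by have := h1 x; lra.
  by exists 0%N; rewrite /= /s big_ord0 hU// subr0 oppr_lt0.
have : L h <= \sum_(i < n) omega (U i) + e.
  apply: (@le_trans _ _ (L (fun x => s n x + e))).
    apply: le_functional => //.
      by apply: continuous_add => //; exact: continuous_const.
    by move=> x; have /= := hn x; lra.
  rewrite (functional_add pL)//; last exact: continuous_const.
  rewrite functional_cst lerD2r /s.
  rewrite (functional_sum n (f := fun i => bump (U i) n)); last first.
    by move=> i; exact: continuous_bump.
  by apply: ler_sum => i _; exact: omega_ge.
rewrite -lee_fin => /le_trans; apply; rewrite EFinD leeD2r// -sumEFin.
rewrite -(big_mkord xpredT (fun i => (omega (U i))%:E)).
by apply: nneseries_lim_ge => i _ _; rewrite lee_fin.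
Qed.

Let rho (A : set (circle R)) : R :=
  inf [set omega U | U in [set U | open U /\ A `<=` U]].

Let rho_lb A : lbound [set omega U | U in [set U | open U /\ A `<=` U]] 0.
Proof. by move=> _ [U _ <-]. Qed.

Let rho_le A U : open U -> A `<=` U -> rho A <= omega U.
Proof.
by move=> oU AU; apply: ge_inf; [exists 0; exact: rho_lb|exists U].
Qed.

Let rho_ge A c : (forall U, open U -> A `<=` U -> c <= omega U) -> c <= rho A.
Proof.
move=> hc; apply: lb_le_inf.
  by exists (omega setT); exists setT => //; split=> //; exact: openT.
by move=> _ [U [oU AU] <-]; exact: hc.
Qed.

Let rho_adherent A e : 0 < e ->
  exists U, [/\ open U, A `<=` U & omega U <= rho A + e].
Proof.
move=> e0; have [|_ [U [oU AU] <-] h] := @inf_adherent _ [set omega U | U in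
  [set U | open U /\ A `<=` U]] e e0.
- split; last by exists 0; exact: rho_lb.
  by exists (omega setT); exists setT => //; split=> //; exact: openT.
- by exists U; split=> //; exact: ltW.
Qed.

Let rho_open U : open U -> rho U = omega U.
Proof.
move=> oU; apply/eqP; rewrite eq_le rho_le//=.
by apply: rho_ge => V _; exact: le_omega.
Qed.

Let rho_ge0 A : 0 <= rho A.
Proof. by apply: rho_ge => U _ _; exact: omega_ge0. Qed.

Let outer A : \bar R := (rho A)%:E.

Let outer0 : outer set0 = 0%E.
Proof.
rewrite /outer rho_open; last exact: open0.
congr EFin; apply/eqP; rewrite eq_le omega_ge0 andbT.
apply: omega_le => h [_ _ _ h0].
rewrite (_ : h = fun _ => 0) ?functional_cst//.
by apply/funext => x; exact: h0.
Qed.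

Let outer_ge0 A : (0 <= outer A)%E. Proof. by rewrite lee_fin. Qed.

Let outer_le : {homo outer : A B / A `<=` B >-> (A <= B)%E}.
Proof.
move=> A B AB; rewrite lee_fin; apply: rho_ge => U oU BU.
by apply: rho_le => //; exact: subset_trans BU.
Qed.

Let outer_sigma_subadditive : sigma_subadditive outer.
Proof.
move=> F; apply/lee_addgt0Pr => e e0.
have hU n : exists U, [/\ open U, F n `<=` U & omega U <= rho (F n) + e / (2 ^ n.+1)%:R].
  by apply: rho_adherent; rewrite divr_gt0// ltr0n expn_gt0.
have [U hU'] := choice hU.
apply: (@le_trans _ _ (omega (\bigcup_n U n))%:E).
  rewrite lee_fin; apply: rho_le; first by apply: bigcup_open => n _; case: (hU' n).
  by apply: subset_bigcup => n _; case: (hU' n).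
apply: (le_trans (omega_bigcup _)) => [n|]; first by case: (hU' n).
apply: le_trans (epsilon_trick xpredT _ (ltW e0)); last first.
  by move=> n; exact: outer_ge0.
apply: lee_nneseries => [n _ _|n _]; first by rewrite lee_fin.
by rewrite -EFinD lee_fin; case: (hU' n).
Qed.

Let outer_meas : {outer_measure set (circle R) -> \bar R} :=
  HB.pack outer (isOuterMeasure.Build R (circle R) outer outer0 outer_ge0
    outer_le outer_sigma_subadditive).

(* For [h] below the indicator of [V `&` U], the points of [V] where [h < e]
   form an open set containing [V `\` U]; a function [k] below its indicator can
   be added to the positive part of [h - e] inside [V]. *)
Let open_caratheodory U : open U -> outer_meas.-caratheodory U.
Proof.
move=> oU; apply: le_caratheodory_measurable => X /=.
rewrite /outer -EFinD lee_fin; apply: rho_ge => V oV XV.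
apply: (@le_trans _ _ (rho (V `&` U) + rho (V `&` ~` U))).
  by rewrite lerD// -lee_fin; apply: outer_le; exact: setSI.
rewrite (rho_open (openI oV oU)) -lerBrDr; apply: omega_le => h [ch h0 h1 hVU].
rewrite lerBrDr; apply/ler_addgt0Pr => e e0.
pose W := V `&` [set x | - e < - h x].
have oW : open W.
  by apply: openI => //; apply: open_gt_continuous; exact: continuous_opp.
apply: (@le_trans _ _ (L h + omega W)).
  rewrite lerD2l; apply: rho_le => // x [Vx Ux]; split => //=.
  by rewrite hVU ?oppr0 ?oppr_lt0// => -[].
rewrite -lerBrDl; apply: omega_le => k [ck k0 k1 kW].
pose h' x := Num.max (h x - e) 0.
have ch' : continuous h'.
  apply: continuous_maxr; last exact: continuous_const.
  by apply: continuous_sub => //; exact: continuous_const.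
have : L (fun x => h' x + k x) <= omega V.
  apply: omega_ge; split=> [|x|x|x Vx].
  - exact: continuous_add.
  - by rewrite addr_ge0// le_max lexx orbT.
  - have [Wx|Wx] := pselect (W x).
      have [_ /=] := Wx; rewrite /h' ltrN2 => hxe.
      by rewrite max_r ?add0r// subr_le0 ltW.
    rewrite kW// addr0 ge_max ler01 andbT.
    by have := h1 x; lra.
  - rewrite kW; last by case.
    rewrite /h' hVU; last by case.
    by rewrite max_r ?addr0// sub0r oppr_le0 ltW.
rewrite (functional_add pL)//.
have : L (fun x => h x - e) <= L h'.
  apply: le_functional => //; last by move=> x; rewrite le_max lexx.
  by apply: continuous_sub => //; exact: continuous_const.
rewrite functional_sub//; last exact: continuous_const.
rewrite functional_cst; lra.
Qed.

Let borel_caratheodory A : measurable A -> outer_meas.-caratheodory A.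
Proof.
apply: smallest_sub; last exact: open_caratheodory.
split=> //.
- exact: caratheodory_measurable_set0.
- by move=> B mB; rewrite setTD; exact: caratheodory_measurable_setC.
- by move=> F mF; exact: caratheodory_measurable_bigcup.
Qed.

Let riesz_measure : exists mu : probability (circle R) R,
  forall U, open U -> mu U = (omega U)%:E.
Proof.
have sa : semi_sigma_additive (outer : set (circle R) -> \bar R).
  move=> F mF tF mUF.
  have mF' i : outer_meas.-cara.-measurable (F i) by exact: borel_caratheodory.
  have mUF' : outer_meas.-cara.-measurable (\bigcup_i F i).
    exact: borel_caratheodory.
  exact: (caratheodory_measure_sigma_additive mF' tF mUF').
pose mu1 : {measure set (circle R) -> \bar R} :=
  HB.pack outer (isMeasure.Build _ (circle R) R outer outer0 outer_ge0 sa).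
have mu1T : mu1 setT = 1%E.
  by rewrite /= /outer rho_open ?omegaT//; exact: openT.
pose mu : probability (circle R) R :=
  HB.pack outer (Measure.class mu1)
  (Measure_isProbability.Build _ (circle R) R mu1 mu1T).
by exists mu => U oU; rewrite /= /outer rho_open.
Qed.

(* [h] is the sum of its slices [g i = min (max (h - i/n) 0) 1/n], which
   satisfy [1_(h > (i+1)/n) <= n * g i <= 1_(h > i/n)]. *)
Let functional_le_integral (mu : probability (circle R) R) :
  (forall U, open U -> mu U = (omega U)%:E) ->
  forall h, continuous h -> (forall x, 0 <= h x <= 1) ->
  L h <= \int[mu]_x h x.
Proof.
move=> muE h ch h01; apply/ler_addgt0Pr => e e0.
have [n ne] : exists n, n.+1%:R^-1 <= e.
  exists (Num.truncn e^-1); rewrite invf_ple ?posrE ?ltr0n//.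
  by rewrite ltW// truncnS_gt.
set w := n.+1%:R^-1 in ne; have w0 : 0 < w by rewrite invr_gt0 ltr0n.
pose H k x := Num.min (h x) (k%:R * w).
pose g k x := Num.min (Num.max (h x - k%:R * w) 0) w.
have cH k : continuous (H k).
  by apply: continuous_minr => //; exact: continuous_const.
have cg k : continuous (g k).
  apply: continuous_minr; last exact: continuous_const.
  apply: continuous_maxr; last exact: continuous_const.
  by apply: continuous_sub => //; exact: continuous_const.
have HS k x : H k.+1 x = H k x + g k x.
  rewrite /H /g -natr1 mulrDl mul1r.
  by rewrite /Num.min /Num.max; repeat case: ifP; lra.
pose V k := [set x | k%:R * w < h x].
have oV k : open (V k) by exact: open_gt_continuous.
have Lg k : L (g k) <= w * omega (V k).
  rewrite -ler_pdivrMl// -(functional_scale pL _ (cg k)); apply: omega_ge.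
  have g0 x : 0 <= g k x by rewrite le_min (ltW w0) andbT le_max lexx orbT.
  split=> [|x|x|x /negP].
  - by apply: continuous_mul => //; exact: continuous_const.
  - by rewrite mulr_ge0// invr_ge0 ltW.
  - by rewrite ler_pdivrMl// mulr1 ge_min lexx orbT.
  - rewrite -leNgt => hk; rewrite /g max_r ?subr_le0//.
    by rewrite min_l ?mulr0// ltW.
have Ig k : w * omega (V k.+1) <= \int[mu]_x g k x.
  have iV : \int[mu]_x (\1_(V k.+1) x) = omega (V k.+1).
    rewrite /Rintegral integral_indic// ?setIT//.
      by transitivity (fine (omega (V k.+1))%:E) => //; congr fine; exact: muE.
    exact: circle_open_measurable.
  have mV : measurable_fun setT (\1_(V k.+1) : circle R -> R).
    exact: measurable_indic (circle_open_measurable (oV k.+1)).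
  have inV : mu.-integrable setT (EFin \o (\1_(V k.+1) : circle R -> R)).
    apply: (@bounded_integrable _ _ _ _ _ 1) => // x.
    by rewrite indicE; case: (_ \in _); rewrite ?normr1 ?normr0.
  rewrite -iV -RintegralZl//; apply: le_Rintegral_prob.
  - apply: (@bounded_integrable _ _ _ _ _ w); first exact: measurable_funM.
    move=> x; rewrite indicE; case: (_ \in _); rewrite ?mulr1 ?mulr0 ?normr0 ?(ltW w0)//.
    by rewrite gtr0_norm.
  - exact: circle_continuous_integrable (cg k).
  - move=> x; rewrite indicE; have [/set_mem Vx|_] := boolP (_ \in _); last first.
      by rewrite mulr0 le_min (ltW w0) andbT le_max lexx orbT.
    rewrite mulr1 le_min lexx andbT le_max; apply/orP; left.
    by move: Vx; rewrite /V /= -natr1 mulrDl mul1r; lra.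
(* [Lg] bounds a slice above by the measure of [V k] and [Ig] bounds its integral below by that of
   [V k.+1]. The errors telescope, so that all slices together cost at most [w * omega (V 0)], which
   is at most [w <= e]. *)
have key k : L (H k) + w * omega (V k) <= \int[mu]_x H k x + w * omega (V 0%N).
  elim: k => [|k ih].
    rewrite lerD2r (_ : H 0%N = fun _ => 0).
      by rewrite functional_cst Rintegral_prob_cst.
    by apply/funext => x; rewrite /H mul0r min_r//; case/andP: (h01 x).
  have -> : H k.+1 = fun x => H k x + g k x by apply/funext => x; exact: HS.
  rewrite (functional_add pL)// RintegralD//; last 2 first.
  - exact: circle_continuous_integrable (cH k).
  - exact: circle_continuous_integrable (cg k).
  by have := Lg k; have := Ig k; lra.
have Hn : H n.+1 = h.
  apply/funext => x; rewrite /H /w mulfV ?pnatr_eq0// min_l//.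
  by case/andP: (h01 x).
have := key n.+1; rewrite Hn.
have : 0 <= w * omega (V n.+1) by rewrite mulr_ge0// ltW.
have : w * omega (V 0%N) <= w by rewrite -[leRHS]mulr1 ler_pM2l.
by lra.
Qed.

(** The inequality for [f] and for [1 - f] gives equality when [f] has values between 0 and 1; an
    affine change of values gives the general case. *)
Theorem riesz_representation : exists mu : probability (circle R) R,
  forall h, continuous h -> \int[mu]_x h x = L h.
Proof.
have [mu muE] := riesz_measure; exists mu => h ch.
have ile := functional_le_integral muE.
have i01 f : continuous f -> (forall x, 0 <= f x <= 1) -> \int[mu]_x f x = L f.
  move=> cf f01; apply/eqP; rewrite eq_le ile// andbT.
  have c1 : continuous (fun _ : circle R => 1 : R) by exact: continuous_const.
  have := ile (fun x => 1 - f x) (continuous_sub c1 cf).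
  rewrite functional_sub// functional_cst RintegralB//; last 2 first.
  - exact: circle_continuous_integrable.
  - exact: circle_continuous_integrable.
  rewrite Rintegral_prob_cst lerD2l lerN2; apply => x.
  by have /andP[? ?] := f01 x; apply/andP; split; lra.
have [M M0 hM] := circle_continuous_bounded ch.
(* [M + 1] instead of [M] keeps the scaling factor positive when the bound [M] is 0. *)
pose f x := (2 * (M + 1))^-1 * (h x + (M + 1)).
have cM : continuous (fun _ : circle R => M + 1) by exact: continuous_const.
have chM : continuous (fun x => h x + (M + 1)) by exact: continuous_add.
have cf : continuous f.
  by apply: continuous_mul => //; exact: continuous_const.
have M1 : 0 < 2 * (M + 1) by lra.
have f01 x : 0 <= f x <= 1.
  have := hM x; rewrite ler_norml => /andP[? ?].
  apply/andP; split; first by rewrite mulr_ge0 ?invr_ge0; lra.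
  by rewrite /f ler_pdivrMl//; lra.
have E : \int[mu]_x (h x + (M + 1)) = L (fun x => h x + (M + 1)).
  have c0 : (2 * (M + 1))^-1 != 0 by rewrite invr_eq0 gt_eqF.
  apply: (mulfI c0); rewrite -RintegralZl//; last exact: circle_continuous_integrable.
  by rewrite -(functional_scale pL _ chM); exact: i01.
move: E; rewrite RintegralD//; last 2 first.
- exact: circle_continuous_integrable ch.
- exact: circle_continuous_integrable cM.
by rewrite (functional_add pL)// Rintegral_prob_cst functional_cst => /addIr.
Qed.

End riesz.

(** * The one-sided product space *)

Section path_space.
Context d (T : measurableType d).

Definition path_cons (z : T * paths T) : paths T :=
  fun n => if n is k.+1 then z.2 k else z.1.

Lemma measurable_coordinate n : measurable_fun setT (fun w : paths T => w n).
Proof.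
move=> _ A mA; rewrite setTI; apply: sub_sigma_algebra.
by exists n, A.
Qed.

Lemma measurable_to_paths d' (X : measurableType d') (g : X -> paths T) :
  (forall n, measurable_fun setT (fun x => g x n)) -> measurable_fun setT g.
Proof.
move=> mg; apply: (@measurability _ _ X (paths T) setT g [set C : set (paths T) |
  exists i (A : set T), measurable A /\ C = [set w | A (w i)]]); first by [].
move=> _ [_ [i [A [mA ->]]] <-].
exact: (mg i).
Qed.

Lemma measurable_path_cons : measurable_fun setT path_cons.
Proof.
apply: measurable_to_paths => -[|n] /=; first exact: measurable_fst.
exact: (measurableT_comp (measurable_coordinate n) measurable_snd).
Qed.

Lemma measurable_path_shift : measurable_fun setT (@path_shift T).
Proof. by apply: measurable_to_paths => n; exact: measurable_coordinate. Qed.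

Definition cylinder n (A : nat -> set T) : set (paths T) :=
  [set w | forall i, (i < n)%N -> A i (w i)].

Lemma measurable_cylinder n A : (forall i, measurable (A i)) ->
  measurable (cylinder n A).
Proof.
move=> mA; have -> : cylinder n A =
    \bigcap_(i in [set i | (i < n)%N]) ((fun w : paths T => w i) @^-1` A i).
  by apply/seteqP; split.
apply: bigcap_measurableType => i _.
by rewrite -[X in measurable X]setTI; exact: measurable_coordinate.
Qed.

End path_space.

Section product_measure.
Context d (T : measurableType d) (R : realType) (p : probability T R)
  (P : probability (paths T) R) (hP : is_product_measure p P).

Lemma product_cylinder n A : (forall i, measurable (A i)) ->
  P (cylinder n A) = (\prod_(i < n) p (A i))%E.
Proof. exact: hP. Qed.

(* Both sides are probability measures which agree on cylinders. *)
Lemma product_measure_cons (C : set (paths T)) : measurable C ->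
  P C = (p \x P)%E (@path_cons _ T @^-1` C).
Proof.
pose G := [set C : set (paths T) | exists n A,
  (forall i, measurable (A i)) /\ C = cylinder n A].
have mG : @measurable _ (paths T) = <<s G >>.
  apply/seteqP; split.
    apply: smallest_sub; first exact: smallest_sigma_algebra.
    move=> _ [i [A [mA ->]]]; apply: sub_sigma_algebra.
    exists i.+1, (fun j => if j == i then A else setT); split.
      by move=> j; case: ifP.
    apply/seteqP; split=> w /=; first by move=> Aw j _; case: eqP => [->|].
    by move=> /(_ i (ltnSn i)); rewrite eqxx.
  apply: smallest_sub; first exact: sigma_algebra_measurable.
  by move=> _ [n [A [mA ->]]]; exact: measurable_cylinder.
have GI : setI_closed G.
  move=> _ _ [n [A [mA ->]]] [m [B [mB ->]]].
  exists (maxn n m), (fun i => (if (i < n)%N then A i else setT) `&`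
                               (if (i < m)%N then B i else setT)); split.
    by move=> i; apply: measurableI; case: ifP.
  apply/seteqP; split=> w /=.
    move=> [Aw Bw] i _; split; case: ifP => // h; [exact: Aw|exact: Bw].
  move=> ABw; split=> i im; have := ABw i; rewrite leq_max im ?orbT => /(_ isT) [].
    by [].
  by [].
have mcons := @measurable_path_cons _ T.
pose consf : {mfun _ >-> _} :=
  HB.pack (@path_cons _ T) (isMeasurableFun.Build _ _ _ _ _ mcons).
move=> mC; transitivity (distribution (p \x P)%E consf C); last by [].
apply: (@measure_unique _ R (paths T) G (fun=> setT)) => //.
- by move=> _; exists 0%N, (fun=> setT); split=> //; apply/seteqP; split.
- by rewrite bigcup_const//; exists 0%N.
- move=> _ [n [A [mA ->]]]; apply: (eq_trans (product_cylinder n mA)).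
  rewrite /distribution /pushforward/=.
  case: n => [|n].
    rewrite big_ord0 (_ : _ @^-1` _ = setT); last by apply/seteqP; split.
    by rewrite (@probability_setT _ _ _ (p \x P)%E).
  have -> : @path_cons _ T @^-1` cylinder n.+1 A =
      A 0%N `*` cylinder n (fun i => A i.+1).
    apply/seteqP; split=> [[t w] /= h|[t w] /= [A0 Aw] [|i]//].
      split; first exact: (h 0%N).
      by move=> i im; exact: (h i.+1).
    exact: Aw.
  rewrite product_measure1E//; last exact: measurable_cylinder.
  rewrite big_ord_recl; congr (_ * _)%E; apply/esym.
  exact: (product_cylinder n (fun i => mA i.+1)).
- by move=> _ /=; apply: le_lt_trans (ltry 1); rewrite -(@probability_setT _ _ _ P).
Qed.

(** Conditioning on the first letter: the rest of the path again has law [P]. Independence is mostly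
    used in this one-step form. *)
Lemma ge0_integral_cons (g : paths T -> \bar R) : measurable_fun setT g ->
  (forall w, 0 <= g w)%E ->
  (\int[P]_w g w = \int[p]_t \int[P]_w g (path_cons (t, w)))%E.
Proof.
move=> mg g0; have mcons := @measurable_path_cons _ T.
pose consf : {mfun _ >-> _} :=
  HB.pack (@path_cons _ T) (isMeasurableFun.Build _ _ _ _ _ mcons).
rewrite (eq_measure_integral (distribution (p \x P)%E consf)); last first.
  by move=> C mC _; exact: product_measure_cons.
rewrite ge0_integral_pushforward//.
rewrite preimage_setT fubini_tonelli1//; last by move=> z; exact: g0.
exact: measurableT_comp.
Qed.

Lemma measure_shift (C : set (paths T)) : measurable C ->
  P (@path_shift T @^-1` C) = P C.
Proof.
move=> mC; rewrite product_measure_cons; last first.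
  by rewrite -[X in measurable X]setTI; exact: measurable_path_shift.
have -> : @path_cons _ T @^-1` (@path_shift T @^-1` C) = setT `*` C.
  by apply/seteqP; split=> [[t w]|[t w] []].
rewrite product_measure1E// -[RHS]mul1e; congr (_ * _)%E.
exact: probability_setT.
Qed.

Lemma ae_shift (Q : paths T -> Prop) : {ae P, forall w, Q w} ->
  {ae P, forall w, Q (path_shift w)}.
Proof.
move=> [N [mN N0 QN]]; exists (@path_shift T @^-1` N); split.
- by rewrite -[X in measurable X]setTI; exact: measurable_path_shift.
- by rewrite measure_shift.
- by move=> w /= /QN.
Qed.

Lemma ae_iter_shift (Q : paths T -> Prop) : {ae P, forall w, Q w} ->
  {ae P, forall w n, Q (iter n (@path_shift T) w)}.
Proof.
move=> hQ; apply/ae_foralln; elim=> [//|n ih].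
by apply: filterS (ae_shift ih) => w; rewrite -iterSr.
Qed.

Lemma ae_coordinates (A : set T) : measurable A -> p A = 1%E ->
  {ae P, forall w n, A (w n)}.
Proof.
move=> mA pA.
have : {ae P, forall w, A (w 0%N)}.
  exists (~` cylinder 1 (fun=> A)); split.
  - by apply: measurableC; exact: measurable_cylinder.
  - rewrite probability_setC; last exact: measurable_cylinder.
    have -> : P (cylinder 1 (fun=> A)) = 1%E; last by rewrite subee.
    by apply: eq_trans (product_cylinder 1 (fun=> mA)) _; rewrite big_ord1.
  - by move=> w /=; apply: contra_not => /(_ 0%N isT).
move=> /ae_iter_shift; apply: filterS => w h n.
have -> : w n = iter n (@path_shift T) w 0%N; last exact: h.
rewrite -[in LHS](addn0 n).
by elim: n 0%N {h} => [//|n ih] m; rewrite addSnnS ih.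
Qed.

End product_measure.

(** * Birkhoff sums of bounded martingale differences *)

Section cocycle_theory.
Context d (T : measurableType d) (R : realType).
Implicit Types (f : T -> circle R -> circle R) (w : paths T) (x : circle R).

(** The definition of [cocycle] splits off the last map. Splitting off the first one lets an
    induction condition on the first letter and restart from the shifted path at a new point. *)
Lemma cocycle_shift f n w x :
  cocycle f n.+1 w x = cocycle f n (path_shift w) (f (w 0%N) x).
Proof. by elim: n => [//|n ih] /=; rewrite -ih. Qed.

Lemma eq_cocycle f g n w : (forall k, f (w k) = g (w k)) ->
  cocycle f n w = cocycle g n w.
Proof. by move=> fg; elim: n => [//|n ih] /=; rewrite ih fg. Qed.

Definition birkhoff_sum f (psi : T * circle R -> R) n w x : R :=
  \sum_(k < n) psi (w k, cocycle f k w x).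

Lemma birkhoff_sum0 f psi w x : birkhoff_sum f psi 0 w x = 0.
Proof. exact: big_ord0. Qed.

Lemma birkhoff_sumS f psi n w x : birkhoff_sum f psi n.+1 w x =
  birkhoff_sum f psi n w x + psi (w n, cocycle f n w x).
Proof. exact: big_ord_recr. Qed.

Lemma birkhoff_sum_shift f psi n w x : birkhoff_sum f psi n.+1 w x =
  psi (w 0%N, x) + birkhoff_sum f psi n (path_shift w) (f (w 0%N) x).
Proof.
rewrite /birkhoff_sum big_ord_recl/=; congr (_ + _).
by apply: eq_bigr => i _; rewrite -cocycle_shift.
Qed.

End cocycle_theory.

Section real_inequalities.
Context (R : realType).

(** From [1 - y <= expR (- y)] one gets [(1 - y) * expR y <= 1], while
    [(1 - y) * (1 + y + 2 * y ^+ 2)] is at least 1 exactly because [2 * y <= 1]. *)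
Lemma expR_le_quadratic (y : R) : y <= 2^-1 -> expR y <= 1 + y + 2 * y ^+ 2.
Proof.
move=> y2; have := expR_ge1Dx (- y); rewrite expRN => h.
have e0 := expR_gt0 y.
have h1 : (1 - y) * expR y <= 1.
  by rewrite -ler_pdivlMr// div1r.
have h2 : 1 <= (1 - y) * (1 + y + 2 * y ^+ 2).
  have -> : (1 - y) * (1 + y + 2 * y ^+ 2) = 1 + y ^+ 2 * (1 - 2 * y) by ring.
  by rewrite lerDl mulr_ge0 ?sqr_ge0//; lra.
have y1 : 0 < 1 - y by lra.
by rewrite -(ler_pM2l y1); exact: le_trans h2.
Qed.

Lemma nneseries_geometric_lty (r : R) : 0 <= r < 1 ->
  (\sum_(n <oo) (r ^+ n)%:E < +oo)%E.
Proof.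
move=> /andP[r0 r1]; have r1' : 0 < 1 - r by lra.
have pn n : \sum_(k < n) r ^+ k <= (1 - r)^-1.
  suff -> : \sum_(k < n) r ^+ k = (1 - r ^+ n) / (1 - r).
    by rewrite -[leRHS]mul1r ler_pM2r ?invr_gt0// gerBl exprn_ge0.
  elim: n => [|n ih]; first by rewrite big_ord0 expr0 subrr mul0r.
  by rewrite big_ord_recr/= ih exprS; field; lra.
apply: (@le_lt_trans _ _ ((1 - r)^-1)%:E); last exact: ltry.
apply: lime_le.
  by apply: is_cvg_nneseries => n _ _; rewrite lee_fin exprn_ge0.
by apply: nearW => n; rewrite big_mkord sumEFin lee_fin.
Qed.

Lemma ge0_markov d (X : measurableType d) (m : {measure set X -> \bar R})
    (g : X -> R) (a : R) : measurable_fun setT g -> (forall x, 0 <= g x) ->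
  0 < a -> (a%:E * m [set x | (a <= g x)%R] <= \int[m]_x (g x)%:E)%E.
Proof.
move=> mg g0 a0; have mA : measurable [set x | a <= g x].
  by rewrite -[X in measurable X]setTI; apply: measurable_fun_le.
rewrite -(integral_cst m mA a%:E).
apply: (@le_trans _ _ (\int[m]_(x in [set x | (a <= g x)%R]) (g x)%:E)%E).
  apply: ge0_le_integral => //.
  - by move=> x _; rewrite lee_fin ltW.
  - by apply/measurable_EFinP; exact: measurable_funTS.
apply: ge0_subset_integral => //.
  exact/measurable_EFinP.
by move=> x _; rewrite lee_fin.
Qed.

End real_inequalities.

Section bounded_martingale.
Context d (T : measurableType d) (R : realType) (p : probability T R)
  (P : probability (paths T) R) (hP : is_product_measure p P)
  (F : T * circle R -> circle R) (mF : measurable_fun setT F).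

Let f t x := F (t, x).

Lemma measurable_cocycle n :
  measurable_fun setT (fun z : paths T * circle R => cocycle f n z.1 z.2).
Proof.
elim: n => [|n ih] /=; first exact: measurable_snd.
apply: (measurableT_comp mF); apply/measurable_fun_pair => //.
exact: (measurableT_comp (measurable_coordinate n) measurable_fst).
Qed.

Lemma measurable_birkhoff_sum psi n : measurable_fun setT psi ->
  measurable_fun setT
    (fun z : paths T * circle R => birkhoff_sum f psi n z.1 z.2).
Proof.
move=> mpsi; apply: measurable_sum => k.
apply: (measurableT_comp mpsi); apply/measurable_fun_pair.
  exact: (measurableT_comp (measurable_coordinate k) measurable_fst).
exact: measurable_cocycle.
Qed.

Lemma measurable_birkhoff_sum1 psi n x : measurable_fun setT psi ->
  measurable_fun setT (fun w : paths T => birkhoff_sum f psi n w x).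
Proof.
move=> /(measurable_birkhoff_sum n) m.
exact: (measurableT_comp m (pair2_measurable x)).
Qed.

Section exponential_moment.
Context (psi : T * circle R -> R) (mpsi : measurable_fun setT psi) (B : R).
Hypothesis psiB : forall z, `|psi z| <= B.
Hypothesis psi0 : forall x, \int[p]_t psi (t, x) = 0.

Let mpsi1 x : measurable_fun setT (fun t => psi (t, x)).
Proof. exact: (measurableT_comp mpsi (pair2_measurable x)). Qed.

(** In the quadratic bound for the exponential the linear term has mean 0, and the rest is at most
    [1 + 2 * (h * B) ^+ 2]. *)
Let exp_moment1 (h : R) x : 0 <= h -> h * B <= 2^-1 ->
  (\int[p]_t (expR (h * psi (t, x)))%:E <= (expR (2 * (h * B) ^+ 2))%:E)%E.
Proof.
move=> h0 hB.
have B0 : 0 <= B by apply: le_trans (psiB (point, x)).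
have hpsi t : `|h * psi (t, x)| <= h * B.
  by rewrite normrM ger0_norm// ler_wpM2l.
have q t : expR (h * psi (t, x)) <= h * psi (t, x) + (1 + 2 * (h * B) ^+ 2).
  apply: le_trans (expR_le_quadratic _) _.
    by apply: le_trans (ler_norm _) _; exact: le_trans (hpsi t) hB.
  rewrite [1 + _]addrC -addrA !lerD2l ler_pM2l//.
  by rewrite -[leLHS]real_normK ?num_real// lerXn2r ?nnegrE ?mulr_ge0.
have ipsi : p.-integrable setT (EFin \o (fun t => psi (t, x))).
  exact: bounded_integrable (mpsi1 x) (fun t => psiB (t, x)).
have ihpsi : p.-integrable setT (EFin \o (fun t => h * psi (t, x))).
  by apply: bounded_integrable hpsi; exact: measurable_funM.
have ir : p.-integrable setT
    (EFin \o (fun t => h * psi (t, x) + (1 + 2 * (h * B) ^+ 2))).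
  exact: (integrableD measurableT ihpsi (integrable_prob_cst p _)).
have mexp : measurable_fun setT (fun t => expR (h * psi (t, x))).
  by apply: measurableT_comp => //; exact: measurable_funM.
apply: (@le_trans _ _
    (\int[p]_t (h * psi (t, x) + (1 + 2 * (h * B) ^+ 2))%:E)%E).
  apply: ge0_le_integral => //.
  - exact/measurable_EFinP.
  - by case/integrableP: ir.
  - by move=> t _; rewrite lee_fin.
have := integrable_fin_num measurableT ir => /fineK <-.
rewrite lee_fin -/(Rintegral p setT _) RintegralD//; last exact: integrable_prob_cst.
rewrite Rintegral_prob_cst RintegralZl// psi0 mulr0 add0r.
exact: expR_ge1Dx.
Qed.

Let mexpS n h : measurable_fun setT (fun z : paths T * circle R =>
  expR (h * birkhoff_sum f psi n z.1 z.2)).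
Proof.
apply: measurableT_comp => //; apply: measurable_funM => //.
exact: measurable_birkhoff_sum.
Qed.

(** Once the first letter is fixed, the induction hypothesis is applied at the point reached after
    one step. The bound must therefore be uniform in the starting point, and [x] is generalized in
    the induction. *)
Lemma exp_moment (h : R) n x : 0 <= h -> h * B <= 2^-1 ->
  (\int[P]_w (expR (h * birkhoff_sum f psi n w x))%:E <=
   (expR (2 * (h * B) ^+ 2) ^+ n)%:E)%E.
Proof.
move=> h0 hB; elim: n x => [|n ih] x.
  under eq_integral do rewrite birkhoff_sum0 mulr0 expR0.
  by rewrite expr0 integral_cst// mul1e probability_le1.
set c := expR _; have c0 : 0 <= c by exact: expR_ge0.
rewrite (ge0_integral_cons hP); last 2 first.
- apply/measurable_EFinP.
  exact: (measurableT_comp (mexpS n.+1 h) (pair2_measurable x)).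
- by move=> w; rewrite lee_fin expR_ge0.
have mexp1 : measurable_fun setT (fun t => expR (h * psi (t, x))).
  by apply: measurableT_comp => //; exact: measurable_funM.
apply: (@le_trans _ _ (\int[p]_t ((c ^+ n)%:E * (expR (h * psi (t, x)))%:E))%E).
  apply: ge0_le_integral => //.
  - by move=> t _; apply: integral_ge0 => w _; rewrite lee_fin expR_ge0.
  - apply: (measurable_fun_fubini_tonelli_F
      (fun z : T * paths T => (expR (h * birkhoff_sum f psi n.+1 (path_cons z) x))%:E)).
      apply/measurable_EFinP.
      have mx : measurable_fun setT (fun z : T * paths T => (path_cons z, x)).
        by apply/measurable_fun_pair => //; exact: measurable_path_cons.
      exact: (measurableT_comp (mexpS n.+1 h) mx).
    by move=> z; rewrite lee_fin expR_ge0.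
  - by under eq_fun do rewrite -EFinM; apply/measurable_EFinP; exact: measurable_funM.
  - move=> t _.
    under eq_integral do rewrite birkhoff_sum_shift/= mulrDr expRD EFinM.
    rewrite ge0_integralZl//; last first.
      apply/measurable_EFinP.
      exact: (measurableT_comp (mexpS n h) (pair2_measurable (f t x))).
    by rewrite muleC lee_wpmul2r ?lee_fin ?expR_ge0//; exact: ih.
rewrite ge0_integralZl//; last 2 first.
- exact/measurable_EFinP.
- by rewrite lee_fin exprn_ge0.
rewrite exprSr EFinM lee_wpmul2l ?lee_fin ?exprn_ge0//.
exact: exp_moment1.
Qed.

(* Chernoff's bound, optimized at [h = e / (4 (B + e)^2)]. *)
Lemma birkhoff_sum_eventually_lt (e : R) x : 0 < e ->
  {ae P, forall w, exists N, forall n, (N <= n)%N ->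
    birkhoff_sum f psi n w x < n%:R * e}.
Proof.
move=> e0; have B0 : 0 <= B by apply: le_trans (psiB (point, x)).
(* The denominator is positive even when [B = 0]. This [h] satisfies [h * B <= 1/2], as [exp_moment]
   requires, and [2 * (h * B) ^+ 2 <= h * e / 2], so half of the exponent [h * e] survives in
   Chernoff's bound. *)
pose h := e / (4 * (B + e) ^+ 2).
have Be0 : 0 < B + e by lra.
have h0 : 0 < h by rewrite divr_gt0// mulr_gt0// exprn_gt0.
have hBe : h * (B + e) ^+ 2 = e / 4.
  by rewrite /h; field; lra.
have hB : h * B <= 2^-1.
  have : h * B * (B + e) <= 2^-1 * (B + e).
    apply: (@le_trans _ _ (h * (B + e) ^+ 2)).
      by rewrite expr2 mulrA ler_pM2r// ler_pM2l//; lra.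
    by rewrite hBe; lra.
  by rewrite ler_pM2r.
have hB2 : 2 * (h * B) ^+ 2 <= h * e / 2.
  have : h * B ^+ 2 <= e / 4.
    by rewrite -hBe ler_pM2l// lerXn2r ?nnegrE//; lra.
  by rewrite exprMn => ?; nra.
pose A n := [set w | n%:R * e <= birkhoff_sum f psi n w x].
have mA n : measurable (A n).
  rewrite -[X in measurable X]setTI; apply: measurable_fun_le => //.
  exact: measurable_birkhoff_sum1.
pose r := expR (- (h * e / 2)).
have PA n : (P (A n) <= (r ^+ n)%:E)%E.
  have a0 : 0 < expR (h * (n%:R * e)) by exact: expR_gt0.
  have -> : A n = [set w | expR (h * (n%:R * e)) <=
                           expR (h * birkhoff_sum f psi n w x)].
    by apply/seteqP; split=> w /=; rewrite ler_expR ler_pM2l.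
  rewrite -(@lee_pmul2l _ (expR (h * (n%:R * e)))%:E)//.
  apply: (le_trans (ge0_markov P _ _ a0)).
  - exact: (measurableT_comp (mexpS n h) (pair2_measurable x)).
  - by move=> w; exact: expR_ge0.
  apply: (le_trans (exp_moment n x (ltW h0) hB)).
  rewrite -EFinM lee_fin /r -!expRM_natl -expRD ler_expR.
  rewrite (_ : h * (n%:R * e) + _ = n%:R * (h * e / 2)).
    by rewrite ler_wpM2l.
  by field.
have : P (lim_sup_set A) = 0%E.
  apply: lim_sup_set_cvg0 => //.
  apply: (@le_lt_trans _ _ (\sum_(n <oo) (r ^+ n)%:E)%E).
    by apply: lee_nneseries => [n _ _|n _]; [exact: measure_ge0|exact: PA].
  apply: nneseries_geometric_lty; rewrite expR_ge0/= /r expR_lt1.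
  by rewrite oppr_lt0 divr_gt0// mulr_gt0.
move=> PA0; exists (lim_sup_set A); split=> //.
  by apply: bigcap_measurableType => n _; exact: bigcup_measurable.
move=> w /= /forallNP hw n _.
have /existsNP[k /not_implyP[nk /negP]] := hw n.
by rewrite -leNgt => kA; exists k.
Qed.

End exponential_moment.

(** The one-sided estimate for [psi] and for [- psi], taken at the countably many values
    [1 / (k + 1)], leaves a single null set that serves all [e]. *)
Theorem birkhoff_sum_mean0 (psi : T * circle R -> R) B x :
  measurable_fun setT psi ->
  (forall z, `|psi z| <= B) -> (forall x, \int[p]_t psi (t, x) = 0) ->
  {ae P, forall w, forall e, 0 < e -> exists N, forall n, (N <= n)%N ->
    `|birkhoff_sum f psi n w x| <= n%:R * e}.
Proof.
move=> mpsi psiB psi0.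
have mN : measurable_fun setT (fun z => - psi z) by exact: measurable_funN.
have NB z : `|- psi z| <= B by rewrite normrN.
have N0 x' : \int[p]_t (- psi (t, x')) = 0.
  under eq_Rintegral do rewrite -mulN1r.
  rewrite RintegralZl// ?psi0 ?mulr0//.
  apply: bounded_integrable (fun t => psiB (t, x')).
  exact: (measurableT_comp mpsi (pair2_measurable x')).
have SN n w : birkhoff_sum f (fun z => - psi z) n w x = - birkhoff_sum f psi n w x.
  by rewrite /birkhoff_sum -sumrN.
have e_ k : 0 < k.+1%:R^-1 :> R by rewrite invr_gt0 ltr0n.
have H1 := ae_foralln (fun k => birkhoff_sum_eventually_lt mpsi psiB psi0 x (e_ k)).
have H2 := ae_foralln (fun k => birkhoff_sum_eventually_lt mN NB N0 x (e_ k)).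
apply: filterS2 H1 H2 => w h1 h2 e e0.
have [k ke] : exists k, k.+1%:R^-1 <= e.
  exists (Num.truncn e^-1); rewrite invf_ple ?posrE ?ltr0n//.
  by rewrite ltW// truncnS_gt.
have [N1 hN1] := h1 k; have [N2 hN2] := h2 k.
exists (maxn N1 N2) => n; rewrite geq_max => /andP[n1 n2].
have := hN1 n n1; have := hN2 n n2; rewrite SN => a b.
have : n%:R * k.+1%:R^-1 <= n%:R * e by rewrite ler_wpM2l.
move=> c; rewrite ler_norml lerNl; apply/andP.
by split; apply: le_trans c; exact: ltW.
Qed.

End bounded_martingale.

(** * The transfer operator *)

Section ultrafilter_limit.
Context (R : realType) (U : set_system nat) (UU : UltraFilter U).

(** The image of the ultrafilter clusters at a point of the compact segment, and an ultrafilter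
    converges to each of its cluster points. *)
Lemma ultra_bounded_cvg (u : nat -> R) M : (forall n, `|u n| <= M) ->
  cvg (u @ U).
Proof.
move=> uM; have cK : compact `[- M, M] by exact: segment_compact.
have PU : ProperFilter U by exact: ultra_proper.
have [|l [_ ul]] := cK (u @ U) _.
- have uK n : `[- M, M]%classic (u n) by rewrite /= in_itv/= -ler_norml.
  exact: (@filterE _ U _ _ uK).
- apply/cvg_ex; exists l => V lV.
  have [//|UV] := in_ultra_setVsetC (u @^-1` V) UU.
  by have [r [/= nVr Vr]] := ul (~` V) V UV lV.
Qed.

End ultrafilter_limit.

(** * Integrals under measure-preserving maps *)

Section measure_preserving.
Context d d' (X : measurableType d) (Y : measurableType d') (R : realType)
  (mX : {measure set X -> \bar R}) (mY : {measure set Y -> \bar R})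
  (phi : X -> Y) (mphi : measurable_fun setT phi).

Hypothesis pres : forall A, measurable A -> mX (phi @^-1` A) = mY A.

Lemma integrable_preserving (h : Y -> \bar R) :
  mY.-integrable setT h -> mX.-integrable setT (h \o phi).
Proof.
move=> /integrableP[mh ih]; apply/integrableP; split.
  exact: (measurableT_comp mh mphi).
pose f : {mfun _ >-> _} := HB.pack phi (isMeasurableFun.Build _ _ _ _ _ mphi).
move: ih; rewrite (eq_measure_integral (pushforward mX f)); last first.
  by move=> A mA _; rewrite -pres.
by rewrite ge0_integral_pushforward//; exact: measurableT_comp.
Qed.

Lemma integral_preserving (h : Y -> \bar R) :
  measurable_fun setT h -> mX.-integrable setT (h \o phi) ->
  (\int[mX]_x h (phi x) = \int[mY]_y h y)%E.
Proof.
move=> mh ih.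
pose f : {mfun _ >-> _} := HB.pack phi (isMeasurableFun.Build _ _ _ _ _ mphi).
rewrite [RHS](eq_measure_integral (pushforward mX f)); last first.
  by move=> A mA _; rewrite -pres.
exact/esym/(integral_pushforward mphi mh ih measurableT).
Qed.

End measure_preserving.

Section circle_parameter_integral.
Context d (T : measurableType d) (R : realType) (p : probability T R).

(** [circle_continuousP] replaces the point of the circle by a real rotation angle, to which
    continuity under the integral sign applies. *)
Lemma continuous_integral_circle (phi : T * circle R -> R) (K : T -> R) :
  measurable_fun setT phi -> (forall t, continuous (fun x => phi (t, x))) ->
  p.-integrable setT (EFin \o K) -> (forall t x, `|phi (t, x)| <= K t) ->
  continuous (fun x => \int[p]_t phi (t, x)).
Proof.
move=> mphi cphi iK phiK x; apply/circle_continuousP.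
have iphi y : p.-integrable setT (EFin \o (fun t => phi (t, y))).
  apply: le_integrable iK => //.
    apply/measurable_EFinP; exact: (measurableT_comp mphi (pair2_measurable y)).
  move=> t _ /=; rewrite lee_fin; apply: le_trans (phiK t y) _.
  exact: ler_norm.
pose f (s : R) t := phi (t, rotate s x).
have cont : {in `]-1, 1[%classic, continuous (fun s => \int[p]_(t in setT) f s t)}.
  apply: (@continuity_under_integral _ _ _ p f setT measurableT (-1) 1 _ _ K) => //.
  - by move=> s _; exact: iphi.
  - apply: aeW => t _ s _.
    have c1 : rotate r x @[r --> s] --> rotate s x by exact: continuous_rotate_time.
    have c2 : phi (t, y) @[y --> rotate s x] --> phi (t, rotate s x).
      exact: cphi.
    exact: (cvg_comp _ _ c1 c2).
  - by move=> s _; apply: aeW => t _; exact: phiK.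
have h0 : (0:R) \in `]-1, 1[%classic by rewrite inE/= in_itv/= ltrN10 ltr01.
have := cont 0 h0; rewrite /continuous_at /f/= rotate0; exact.
Qed.

End circle_parameter_integral.

Section transfer_operator.
Context d (T : measurableType d) (R : realType) (p : probability T R)
  (F : T * circle R -> circle R) (mF : measurable_fun setT F)
  (cF : forall t, continuous (fun x => F (t, x))).
Implicit Types (g h : circle R -> R) (nu : probability (circle R) R).

Definition transfer h x : R := \int[p]_t h (F (t, x)).

(** Stationarity in terms of one random step, without the path space. For a version of the random
    map it is equivalent to [stationary], by [stationary_invariant_law] and
    [invariant_law_stationary]. *)
Definition invariant_law nu :=
  forall A, measurable A -> (p \x nu)%E (F @^-1` A) = nu A.

Let continuous_comp_F h t : continuous h -> continuous (fun x => h (F (t, x))).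
Proof.
move=> ch x.
have c1 : F (t, y) @[y --> x] --> F (t, x) by exact: cF.
have c2 : h y @[y --> F (t, x)] --> h (F (t, x)) by exact: ch.
exact: (cvg_comp _ _ c1 c2).
Qed.

Let measurable_comp_F h : continuous h -> measurable_fun setT (h \o F).
Proof.
by move=> /circle_continuous_measurable mh; exact: measurableT_comp mh mF.
Qed.

Lemma integrable_comp_F h x : continuous h ->
  p.-integrable setT (EFin \o (fun t => h (F (t, x)))).
Proof.
move=> ch; have [M _ hM] := circle_continuous_bounded ch.
apply: (@bounded_integrable _ _ _ _ _ M) => [|t]; last exact: hM.
exact: (measurableT_comp (measurable_comp_F ch) (pair2_measurable x)).
Qed.

Lemma continuous_transfer h : continuous h -> continuous (transfer h).
Proof.
move=> ch; have [M _ hM] := circle_continuous_bounded ch.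
apply: (@continuous_integral_circle _ _ _ p (h \o F) (fun=> M)) => //.
- exact: measurable_comp_F.
- by move=> t; exact: continuous_comp_F.
- exact: integrable_prob_cst.
- by move=> t x; exact: hM.
Qed.

Lemma continuous_iter_transfer h k : continuous h -> continuous (iter k transfer h).
Proof. by move=> ch; elim: k => [//|k ih]; exact: continuous_transfer. Qed.

Lemma transfer_bound h M : continuous h -> (forall x, `|h x| <= M) ->
  forall x, `|transfer h x| <= M.
Proof.
by move=> ch hM x; apply: Rintegral_prob_bound => //; exact: integrable_comp_F.
Qed.

Lemma iter_transfer_bound h M k : continuous h -> (forall x, `|h x| <= M) ->
  forall x, `|iter k transfer h x| <= M.
Proof.
move=> ch hM; elim: k => [//|k ih] /=.
by apply: transfer_bound => //; exact: continuous_iter_transfer.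
Qed.

Lemma transfer_add g h : continuous g -> continuous h ->
  transfer (fun x => g x + h x) = fun x => transfer g x + transfer h x.
Proof.
move=> cg ch; apply/funext => x.
by rewrite /transfer RintegralD//; exact: integrable_comp_F.
Qed.

Lemma transfer_scale c h : continuous h ->
  transfer (fun x => c * h x) = fun x => c * transfer h x.
Proof.
move=> ch; apply/funext => x.
by rewrite /transfer RintegralZl//; exact: integrable_comp_F.
Qed.

Lemma transfer_cst c : transfer (fun=> c) = fun=> c.
Proof. by apply/funext => x; rewrite /transfer Rintegral_prob_cst. Qed.

Lemma transfer_ge0 h : (forall x, 0 <= h x) -> forall x, 0 <= transfer h x.
Proof. by move=> h0 x; apply: Rintegral_ge0. Qed.

Lemma iter_transfer_add g h k : continuous g -> continuous h ->
  iter k transfer (fun x => g x + h x) =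
  fun x => iter k transfer g x + iter k transfer h x.
Proof.
move=> cg ch; elim: k => [//|k ih] /=; rewrite ih transfer_add//.
  exact: continuous_iter_transfer.
exact: continuous_iter_transfer.
Qed.

Lemma iter_transfer_scale c h k : continuous h ->
  iter k transfer (fun x => c * h x) = fun x => c * iter k transfer h x.
Proof.
move=> ch; elim: k => [//|k ih] /=; rewrite ih transfer_scale//.
exact: continuous_iter_transfer.
Qed.

Lemma iter_transfer_cst c k : iter k transfer (fun=> c) = fun=> c.
Proof. by elim: k => [//|k ih] /=; rewrite ih transfer_cst. Qed.

Lemma iter_transfer_ge0 h k : (forall x, 0 <= h x) ->
  forall x, 0 <= iter k transfer h x.
Proof. by move=> h0; elim: k => [//|k ih] /=; exact: transfer_ge0. Qed.

(* Every section has to be integrable because the real-valued integral of a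
   non-integrable function may be a junk value. *)
Lemma Rintegral_product nu (phi : T * circle R -> R) :
  (p \x nu)%E.-integrable setT (EFin \o phi) ->
  (forall x, p.-integrable setT (EFin \o (fun t => phi (t, x)))) ->
  \int[(p \x nu)%E]_z phi z = \int[nu]_x \int[p]_t phi (t, x).
Proof.
move=> iphi iphix; rewrite /Rintegral -integral21_prod_meas1//.
congr fine; apply: eq_integral => x _; rewrite /fubini_G/=.
by rewrite fineK//; exact: integrable_fin_num (iphix x).
Qed.

Lemma integral_transfer nu h : continuous h ->
  \int[nu]_x transfer h x = \int[(p \x nu)%E]_z h (F z).
Proof.
move=> ch; have [M _ hM] := circle_continuous_bounded ch.
rewrite Rintegral_product//.
  apply: (@bounded_integrable _ _ _ (p \x nu)%E _ M) => [|z]; last exact: hM.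
  exact: measurable_comp_F.
by move=> x; exact: integrable_comp_F.
Qed.

(** The integral of [transfer h] is that of [h] under the image of [p \x nu] by [F], and continuous
    functions separate probabilities on the circle. *)
Lemma transfer_invariant_law nu :
  (forall h, continuous h -> \int[nu]_x transfer h x = \int[nu]_x h x) ->
  invariant_law nu.
Proof.
move=> inv A mA.
pose f : {mfun _ >-> _} := HB.pack F (isMeasurableFun.Build _ _ _ _ _ mF).
transitivity (distribution (p \x nu)%E f A); first by [].
apply: circle_probability_eq => // h ch _.
have [M _ hM] := circle_continuous_bounded ch.
have ihF : (p \x nu)%E.-integrable setT (EFin \o (h \o F)).
  apply: (@bounded_integrable _ _ _ (p \x nu)%E _ M) => [|z]; last exact: hM.
  exact: measurable_comp_F.
rewrite integral_pushforward//; last first.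
  by apply/measurable_EFinP; exact: circle_continuous_measurable.
have := inv h ch; rewrite integral_transfer// /Rintegral => E.
have ih := circle_continuous_integrable nu ch.
rewrite -[LHS]fineK; last exact: integrable_fin_num ihF.
by rewrite -[RHS]fineK; [congr EFin|exact: integrable_fin_num ih].
Qed.

(** The average has [n.+1] terms, so its divisor is never 0. *)
Definition transfer_average h n x : R :=
  n.+1%:R^-1 * \sum_(k < n.+1) iter k transfer h x.

Lemma transfer_average_bound h M n : continuous h -> (forall x, `|h x| <= M) ->
  forall x, `|transfer_average h n x| <= M.
Proof.
move=> ch hM x; rewrite /transfer_average normrM ger0_norm ?invr_ge0//.
rewrite ler_pdivrMl ?ltr0n//; apply: le_trans (ler_norm_sum _ _ _) _.
apply: le_trans (_ : \sum_(k < n.+1) M <= _).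
  by apply: ler_sum => k _; exact: iter_transfer_bound.
by rewrite sumr_const card_ord mulr_natl.
Qed.

(* If the averages at some points [xs n] stayed away from the integral, an
   ultrafilter limit of [h |-> transfer_average h n (xs n)] would represent
   another invariant law. *)
Theorem uniform_transfer_average (mu : probability (circle R) R) g e :
  (forall nu, invariant_law nu -> forall A, measurable A -> nu A = mu A) ->
  continuous g -> 0 < e ->
  exists n, forall x, `|transfer_average g n x - \int[mu]_y g y| <= e.
Proof.
move=> uniq cg e0; apply: contrapT => /forallNP H.
have {}H n : exists x, e < `|transfer_average g n x - \int[mu]_y g y|.
  by have /existsNP[x /negP] := H n; rewrite -ltNge => ?; exists x.
have [xs hxs] := choice H.
(* One ultrafilter gives a limit for every continuous [h] simultaneously, and limits along a fixed
   filter respect sums and multiples; hence [L] is linear. *)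
have [U [UU sU]] := ultraFilterLemma (F := \oo) _.
have PU : ProperFilter U by exact: ultra_proper.
pose u h n := transfer_average h n (xs n).
have ucvg h : continuous h -> cvg (u h @ U).
  move=> ch; have [M _ hM] := circle_continuous_bounded ch.
  by apply: (ultra_bounded_cvg _ (M := M)) => n; exact: transfer_average_bound.
pose L h := lim (u h @ U).
have Lcvg h : continuous h -> u h @ U --> L h by exact: ucvg.
have pL : positive_functional L.
  split.
  - move=> h1 h2 c1 c2; apply: cvg_lim => //.
    rewrite (_ : u _ = u h1 \+ u h2); first exact: cvgD (Lcvg _ c1) (Lcvg _ c2).
    apply/funext => n; rewrite /u /transfer_average/= -mulrDr -big_split/=.
    by congr (_ * _); apply: eq_bigr => k _; rewrite iter_transfer_add.
  - move=> c h ch; apply: cvg_lim => //.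
    rewrite (_ : u _ = (fun=> c) \* u h).
      by apply: cvgM; [exact: cvg_cst|exact: Lcvg].
    apply/funext => n; rewrite /u /transfer_average/= mulrCA [c * _]mulr_sumr.
    by congr (_ * _); apply: eq_bigr => k _; rewrite iter_transfer_scale.
  - move=> h ch h0; apply: limr_ge; first exact: ucvg.
    apply: filterE => n; rewrite mulr_ge0 ?invr_ge0//.
    by apply: sumr_ge0 => k _; exact: iter_transfer_ge0.
  - apply: cvg_lim => //; rewrite (_ : u _ = fun=> 1); first exact: cvg_cst.
    apply/funext => n; rewrite /u /transfer_average.
    under eq_bigr do rewrite iter_transfer_cst.
    by rewrite sumr_const card_ord mulVf.
(* The sums for [transfer h] and [h] differ only in their end terms, so the averages differ by at
   most [2 * M / n.+1]; a limit along [\oo] is also a limit along the finer [U]. *)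
have LK h : continuous h -> L (transfer h) = L h.
  move=> ch; have [M M0 hM] := circle_continuous_bounded ch.
  apply/eqP; rewrite -subr_eq0; apply/eqP.
  have cK := continuous_transfer ch.
  have : u (transfer h) \- u h @ U --> L (transfer h) - L h.
    exact: cvgB (Lcvg _ cK) (Lcvg _ ch).
  have : u (transfer h) \- u h @ U --> 0.
    apply: (cvg_trans _ (_ : u (transfer h) \- u h @ \oo --> 0)).
      by move=> A /= hA; exact: sU.
    apply/cvgrPdist_le => d0 d00.
    exists (Num.truncn (2 * M / d0)).+1 => // n /= hn.
    rewrite sub0r normrN /u /transfer_average -mulrBr -sumrB.
    under eq_bigr do rewrite -iterSr.
    rewrite (_ : \sum_(i < n.+1) _ = iter n.+1 transfer h (xs n) - h (xs n)).
      rewrite normrM ger0_norm ?invr_ge0// ler_pdivrMl ?ltr0n//.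
      apply: le_trans (ler_normB _ _) _.
      have h1 := iter_transfer_bound n.+1 ch hM (xs n); have h2 := hM (xs n).
      have : 2 * M / d0 <= n.+1%:R.
        apply: ltW; apply: lt_le_trans (truncnS_gt _) _.
        by rewrite ler_nat ltnW.
      rewrite ler_pdivrMr// => h3; apply: le_trans h3.
      by rewrite mulr_natl mulr2n lerD.
    rewrite -(big_mkord xpredT (fun i =>
      iter i.+1 transfer h (xs n) - iter i transfer h (xs n))).
    by rewrite telescope_sumr.
  by move=> a b; exact: cvg_unique b a.
have [nu nuE] := riesz_representation pL.
have inv_nu : invariant_law nu.
  apply: transfer_invariant_law => h ch; rewrite !nuE ?LK//.
  exact: continuous_transfer.
have Lg : L g = \int[mu]_y g y.
  rewrite -nuE//; congr fine; apply: eq_measure_integral => A mA _.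
  exact: uniq.
have := Lcvg g cg; rewrite Lg => /cvgrPdist_lt /(_ e e0) hU.
have [n] : exists n, `|\int[mu]_y g y - u g n| < e by exact: filter_ex hU.
by rewrite distrC ltNge => /negP; apply; exact/ltW/hxs.
Qed.

End transfer_operator.

(** * The maximal inequality *)

Lemma measurable_set_lt d (X : measurableType d) (R : realType) (f g : X -> R) :
  measurable_fun setT f -> measurable_fun setT g ->
  measurable [set x | f x < g x].
Proof.
move=> mf mg; have := measurable_fun_ltr mf mg measurableT (Y := [set true]) I.
rewrite setTI; congr measurable; apply/seteqP; split=> x //=.
Qed.

Section maximal_inequality.
Context d (T : measurableType d) (R : realType) (p : probability T R)
  (P : probability (paths T) R) (hP : is_product_measure p P).

Lemma ge0_integral_shift (g : paths T -> \bar R) : measurable_fun setT g ->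
  (forall w, 0 <= g w)%E -> (\int[P]_w g (path_shift w) = \int[P]_w g w)%E.
Proof.
move=> mg g0; rewrite (ge0_integral_cons hP); last 2 first.
- exact: (measurableT_comp mg (@measurable_path_shift _ T)).
- by move=> w; exact: g0.
rewrite /path_shift /=.
by rewrite integral_cst// [X in (_ * X)%E](@probability_setT _ _ _ p) mule1.
Qed.

Lemma ge0_integral_coordinate0 (g : T -> \bar R) : measurable_fun setT g ->
  (forall t, 0 <= g t)%E -> (\int[P]_w g (w 0%N) = \int[p]_t g t)%E.
Proof.
move=> mg g0; rewrite (ge0_integral_cons hP); last 2 first.
- exact: (measurableT_comp mg (measurable_coordinate 0)).
- by move=> w; exact: g0.
apply: eq_integral => t _ /=.
by rewrite integral_cst// [X in (_ * X)%E](@probability_setT _ _ _ P) mule1.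
Qed.

Section nonnegative.
Context (Y : T -> R) (mY : measurable_fun setT Y) (Y0 : forall t, 0 <= Y t)
  (iY : p.-integrable setT (EFin \o Y)) (a : R) (a0 : 0 < a).

(* [max_excess n w] is the maximum over [j <= n] of the partial sums
   [\sum_(k < j) (Y (w k) - a)]. *)
Fixpoint max_excess n (w : paths T) : R :=
  if n is m.+1 then Num.max 0 (Y (w 0%N) - a + max_excess m (path_shift w))
  else 0.

Lemma max_excess_ge0 n w : 0 <= max_excess n w.
Proof. by case: n => [//|n] /=; rewrite le_max lexx. Qed.

Lemma max_excess_nd n w : max_excess n w <= max_excess n.+1 w.
Proof.
elim: n w => [|n ih] w; first exact: (max_excess_ge0 1).
rewrite [leRHS]/= ge_max le_max lexx/= le_max.
by apply/orP; right; rewrite lerD2l; exact: ih.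
Qed.

Lemma max_excess_ge_sum n (w : paths T) :
  \sum_(k < n) Y (w k) <= max_excess n w + n%:R * a.
Proof.
elim: n w => [|n ih] w; first by rewrite big_ord0 /= mul0r addr0.
rewrite big_ord_recl/= -natr1 mulrDl mul1r.
have := ih (path_shift w); rewrite /path_shift => h.
have : Y (w 0%N) - a + max_excess n (fun k => w k.+1) <=
       Num.max 0 (Y (w 0%N) - a + max_excess n (fun k => w k.+1)).
  by rewrite le_max lexx orbT.
rewrite (eq_bigr (fun i : 'I_n => Y (w i.+1)))//.
by lra.
Qed.

Lemma measurable_max_excess n : measurable_fun setT (max_excess n).
Proof.
elim: n => [|n ih] /=; first exact: measurable_cst.
apply: measurable_maxr => //; apply: measurable_funD.
  apply: measurable_funB => //.
  exact: (measurableT_comp mY (measurable_coordinate 0)).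
exact: (measurableT_comp ih (@measurable_path_shift _ T)).
Qed.

Let mM n : measurable_fun setT (fun w => (max_excess n w)%:E : \bar R).
Proof. by apply/measurable_EFinP; exact: measurable_max_excess. Qed.

Let M0 n w : (0 <= (max_excess n w)%:E)%E.
Proof. by rewrite lee_fin max_excess_ge0. Qed.

Let mY1 : measurable_fun setT (fun w : paths T => (Y (w 0%N))%:E : \bar R).
Proof.
apply/measurable_EFinP.
exact: (measurableT_comp mY (measurable_coordinate 0)).
Qed.

Let EY : (\int[P]_w (Y (w 0%N))%:E = \int[p]_t (Y t)%:E)%E.
Proof.
apply: (@ge0_integral_coordinate0 (EFin \o Y)).
  exact/measurable_EFinP.
by move=> t; rewrite lee_fin.
Qed.

Let EY_lty : (\int[p]_t (Y t)%:E < +oo)%E.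
Proof.
have /integrableP[_] := iY.
by under eq_integral do rewrite /= ger0_norm//.
Qed.

Let EYM n : (\int[P]_w ((Y (w 0%N))%:E + (max_excess n (path_shift w))%:E) =
  \int[p]_t (Y t)%:E + \int[P]_w (max_excess n w)%:E)%E.
Proof.
rewrite ge0_integralD//; last 2 first.
- by move=> w _; rewrite lee_fin.
- exact: (measurableT_comp (mM n) (@measurable_path_shift _ T)).
by rewrite EY (ge0_integral_shift (g := fun w => (max_excess n w)%:E)).
Qed.

(** Finiteness allows this integral to be cancelled from both sides in [maximal_inequality]. *)
Lemma max_excess_lty n : (\int[P]_w (max_excess n w)%:E < +oo)%E.
Proof.
elim: n => [|n ih]; first by rewrite integral0 ltry.
apply: le_lt_trans (_ : _ <= \int[p]_t (Y t)%:E + \int[P]_w (max_excess n w)%:E)%E _.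
  rewrite -EYM; apply: ge0_le_integral => //.
  - apply: emeasurable_funD => //.
    exact: (measurableT_comp (mM n) (@measurable_path_shift _ T)).
  - move=> w _; rewrite -EFinD lee_fin /= ge_max addr_ge0 ?max_excess_ge0//=.
    by rewrite lerD2r gerBl ltW.
by rewrite lte_add_pinfty.
Qed.

(* Garsia's argument: where it is positive, [max_excess n.+1] is at most [Y - a]
   plus its own value at the shifted path, which has the same integral. *)
Lemma maximal_inequality n :
  (a%:E * P [set w : paths T | (0 < max_excess n.+1 w)%R] <= \int[p]_t (Y t)%:E)%E.
Proof.
pose A := [set w : paths T | 0 < max_excess n.+1 w]; rewrite -/A.
have mA : measurable A.
  apply: measurable_set_lt; first exact: measurable_cst.
  exact: measurable_max_excess.
(* Adding [a] on [A] to the left, instead of subtracting it from [Y], keeps both integrands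
   nonnegative; outside [A] the left one is 0. *)
have : (\int[P]_w ((max_excess n.+1 w)%:E + (a * \1_A w)%:E) <=
    \int[p]_t (Y t)%:E + \int[P]_w (max_excess n.+1 w)%:E)%E.
  rewrite -EYM; apply: ge0_le_integral => //.
  - by move=> w _; rewrite -EFinD lee_fin addr_ge0 ?max_excess_ge0// mulr_ge0// ltW.
  - apply: emeasurable_funD => //; apply/measurable_EFinP.
    by apply: measurable_funM => //; exact: measurable_indic.
  - apply: emeasurable_funD => //.
    exact: (measurableT_comp (mM n.+1) (@measurable_path_shift _ T)).
  - move=> w _; rewrite -!EFinD lee_fin indicE.
    have h := max_excess_nd n (path_shift w).
    have hM := max_excess_ge0 n.+1 (path_shift w).
    have [/set_mem Aw|/negP Aw] := boolP (w \in A).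
      move: Aw; rewrite /A/= lt_max ltxx/= => Aw.
      by rewrite max_r ?(ltW Aw)// mulr1; move: h => /=; lra.
    have : max_excess n.+1 w <= 0.
      by rewrite leNgt; apply/negP => hw; apply: Aw; exact: mem_set.
    by rewrite mulr0 addr0 => /le_trans; apply; exact: addr_ge0.
rewrite ge0_integralD//; last 2 first.
- by move=> w _; rewrite lee_fin mulr_ge0// ltW.
- apply/measurable_EFinP.
  by apply: measurable_funM => //; exact: measurable_indic.
rewrite addeC leeD2rE; last first.
  by rewrite ge0_fin_numE ?max_excess_lty// integral_ge0.
under eq_integral do rewrite EFinM.
rewrite ge0_integralZl_EFin//; last 2 first.
- by apply/measurable_EFinP; exact: measurable_indic.
- exact: ltW.
by rewrite integral_indic// setIT.
Qed.

(** The exceptional sets of [maximal_inequality] increase with [n] under a common bound, so their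
    union obeys it as well, and a path outside the union satisfies the estimate for all [n]. *)
Lemma sum_exceeds_le :
  exists B, [/\ measurable B, (a%:E * P B <= \int[p]_t (Y t)%:E)%E &
    forall w : paths T, ~ B w -> forall n, \sum_(k < n) Y (w k) <= n%:R * a].
Proof.
pose A n := [set w : paths T | 0 < max_excess n.+1 w].
have mA n : measurable (A n).
  apply: measurable_set_lt; first exact: measurable_cst.
  exact: measurable_max_excess.
have ndA : nondecreasing_seq A.
  apply/nondecreasing_seqP => n; apply/subsetPset => w /= /lt_le_trans; apply.
  exact: max_excess_nd.
exists (\bigcup_n A n); split.
- exact: bigcup_measurable.
- have cvgP := nondecreasing_cvg_mu (mu := P) mA (bigcup_measurable (fun k _ => mA k)) ndA.
  have : (a%:E * P (A n) @[n --> \oo] --> a%:E * P (\bigcup_n A n))%E.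
    by apply: cvgeZl.
  move=> /cvg_lim <-//; apply: lime_le.
    apply/cvg_ex; eexists; exact: (cvgeZl _ cvgP).
  by apply: nearW => n; exact: maximal_inequality.
- move=> w Bw n; apply: le_trans (max_excess_ge_sum n w) _.
  rewrite -[leRHS]add0r lerD2r leNgt; apply/negP => Mn.
  by apply: Bw; exists n => //; apply: lt_le_trans Mn _; exact: max_excess_nd.
Qed.

End nonnegative.

Section tails.
Context (K : T -> R) (mK : measurable_fun setT K) (K0 : forall t, 0 <= K t)
  (iK : p.-integrable setT (EFin \o K)).

Definition tail (m : nat) t : R := if m%:R < K t then K t else 0.

Lemma tail_ge0 m t : 0 <= tail m t.
Proof. by rewrite /tail; case: ifP. Qed.

Lemma tail_le m t : tail m t <= K t.
Proof. by rewrite /tail; case: ifP. Qed.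

Lemma measurable_tail m : measurable_fun setT (tail m).
Proof.
apply: measurable_fun_ifT => //.
exact: measurable_fun_ltr.
Qed.

Lemma integrable_tail m : p.-integrable setT (EFin \o tail m).
Proof.
apply: le_integrable iK => //.
  by apply/measurable_EFinP; exact: measurable_tail.
move=> t _ /=; rewrite lee_fin !ger0_norm ?tail_ge0//.
exact: tail_le.
Qed.

Lemma integral_tail_small (e : R) : 0 < e ->
  exists m0, forall m, (m0 <= m)%N -> \int[p]_t tail m t <= e.
Proof.
move=> e0.
have : (\int[p]_t (tail m t)%:E @[m --> \oo] --> \int[p]_t (cst 0 t))%E.
  apply: (@dominated_cvg _ _ _ p setT measurableT (fun m t => (tail m t)%:E)
     (cst 0%E) (EFin \o K)) => //.
  - by move=> m; apply/measurable_EFinP; exact: measurable_tail.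
  - move=> t _; apply: cvg_near_cst.
    exists (Num.truncn (K t)).+1 => // m /= hm.
    rewrite /tail ifF//; apply/negbTE; rewrite -leNgt.
    by apply: ltW; apply: lt_le_trans (truncnS_gt _) _; rewrite ler_nat.
  - move=> m t _ /=; rewrite lee_fin ger0_norm ?tail_ge0//.
    exact: tail_le.
rewrite integral0 => /fine_cvg /cvgrPdist_le /(_ e e0)[m0 _ h].
exists m0 => m /h; rewrite /= sub0r normrN ger0_norm//.
by apply: Rintegral_ge0 => t _; exact: tail_ge0.
Qed.

(** The exceptional set at level [m] has measure at most the integral of [tail m] divided by [e],
    which tends to 0. A path for which no level works lies in all these sets from [m0] on; the level
    depends on the path. *)
Lemma ae_sum_tail_small (e : R) : 0 < e ->
  {ae P, forall w : paths T, exists m, \int[p]_t tail m t <= e /\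
    forall n, \sum_(k < n) tail m (w k) <= n%:R * e}.
Proof.
move=> e0; have [m0 hm0] := integral_tail_small e0.
have hB m := sum_exceeds_le (measurable_tail m) (tail_ge0 m) (integrable_tail m) e0.
have [B hB'] := choice hB.
have mB m : measurable (B m) by case: (hB' m).
exists (\bigcap_(m in [set m | (m0 <= m)%N]) B m); split.
- exact: bigcap_measurableType.
- apply/eqP; rewrite eq_le measure_ge0 andbT.
  apply/lee_addgt0Pr => r r0; rewrite add0e.
  have [m1 hm1] := integral_tail_small (mulr_gt0 e0 r0).
  set m := maxn m0 m1.
  apply: (@le_trans _ _ (P (B m))).
    apply: le_measure; rewrite ?inE//; first exact: bigcap_measurableType.
    by apply: bigcap_inf; rewrite /= leq_maxl.
  rewrite -(@lee_pmul2l _ e%:E)//.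
  have [_ hb _] := hB' m; apply: (le_trans hb).
  rewrite -EFinM -[leLHS]fineK; last exact: integrable_fin_num (integrable_tail m).
  by rewrite lee_fin; apply: hm1; rewrite leq_maxr.
- move=> w /= /forallNP hw m m0m; apply: contrapT => nBw; apply: (hw m).
  by split; [exact: hm0|case: (hB' m) => _ _; apply].
Qed.

End tails.
End maximal_inequality.

(** * The strong law of large numbers *)

Section strong_law.
Context d (T : measurableType d) (R : realType) (p : probability T R)
  (P : probability (paths T) R) (hP : is_product_measure p P)
  (F : T * circle R -> circle R) (mF : measurable_fun setT F)
  (cF : forall t, continuous (fun x => F (t, x)))
  (mu : probability (circle R) R)
  (uniq : forall nu, invariant_law p F nu ->
    forall A, measurable A -> nu A = mu A).

Let f t x := F (t, x).

Let inv_succ_le (e : R) : 0 < e -> exists k, k.+1%:R^-1 <= e.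
Proof.
move=> e0; exists (Num.truncn e^-1); rewrite invf_ple ?posrE ?ltr0n//.
by rewrite ltW// truncnS_gt.
Qed.

(* An approximate solution of the Poisson equation [h - transfer h = g - c]. *)
Lemma transfer_coboundary (g : circle R -> R) n : continuous g ->
  exists2 h, continuous h &
    forall x, h x - transfer p F h x = g x - transfer_average p F g n x.
Proof.
move=> cg; have ci k : continuous (iter k (transfer p F) g).
  exact: continuous_iter_transfer.
(* [s j] solves the equation with [iter j (transfer p F) g] in place of the average; averaging the
   solutions over [j <= n] produces [transfer_average]. *)
pose s j x := \sum_(i < j) iter i (transfer p F) g x.
have cs j : continuous (s j).
  exact: (@continuous_sumr _ _ j (fun i => iter i (transfer p F) g)).
have sE j x : s j x - transfer p F (s j) x = g x - iter j (transfer p F) g x.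
  elim: j => [|j ih].
    rewrite (_ : s 0%N = fun=> 0) ?transfer_cst ?subrr//.
    by apply/funext => y; rewrite /s big_ord0.
  rewrite (_ : s j.+1 = fun y => s j y + iter j (transfer p F) g y); last first.
    by apply/funext => y; rewrite /s big_ord_recr.
  rewrite transfer_add// opprD addrACA ih iterS addrA subrK.
  by [].
pose S m x := \sum_(j < m) s j x.
have cS m : continuous (S m) by exact: (@continuous_sumr _ _ m s).
have SE m x : S m x - transfer p F (S m) x =
    m%:R * g x - \sum_(k < m) iter k (transfer p F) g x.
  elim: m => [|m ih].
    rewrite (_ : S 0%N = fun=> 0) ?transfer_cst ?big_ord0 ?mul0r//.
    by apply/funext => y; rewrite /S big_ord0.
  rewrite (_ : S m.+1 = fun y => S m y + s m y); last first.
    by apply/funext => y; rewrite /S big_ord_recr.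
  rewrite transfer_add// opprD addrACA ih sE big_ord_recr/= -natr1 mulrDl mul1r.
  by rewrite [in RHS]opprD addrACA.
exists (fun x => n.+1%:R^-1 * S n.+1 x).
  by apply: continuous_mul => //; exact: continuous_const.
by move=> x; rewrite transfer_scale// -mulrBr SE mulrBr mulrA mulVf ?mul1r.
Qed.

Section bounded.
Context (phi : T * circle R -> R) (mphi : measurable_fun setT phi)
  (cphi : forall t, continuous (fun x => phi (t, x))) (M : R)
  (phiM : forall z, `|phi z| <= M).

Let g x := \int[p]_t phi (t, x).

Let iphi x : p.-integrable setT (EFin \o (fun t => phi (t, x))).
Proof.
apply: (@bounded_integrable _ _ _ _ _ M) => [|t]; last exact: phiM.
exact: (measurableT_comp mphi (pair2_measurable x)).
Qed.

Let cg : continuous g.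
Proof.
apply: (@continuous_integral_circle _ _ _ p phi (fun=> M)) => //.
exact: integrable_prob_cst.
Qed.

Lemma bounded_strong_law x :
  {ae P, forall w, forall e, 0 < e -> exists N, forall n, (N <= n)%N ->
   `|birkhoff_sum f phi n w x - n%:R * \int[(p \x mu)%E]_z phi z| <= n%:R * e}.
Proof.
set c := \int[_]_z phi z.
have cE : \int[mu]_x g x = c.
  rewrite /c Rintegral_product//.
  exact: (@bounded_integrable _ _ _ (p \x mu)%E _ M).
(* The length [n0] of the averages, and with it the coboundary [h], depends on the precision;
   countably many precisions suffice to keep one null set. *)
have H k : {ae P, forall w, forall e, 0 < e -> exists N, forall n, (N <= n)%N ->
   `|birkhoff_sum f phi n w x - n%:R * c| <= n%:R * (k.+1%:R^-1 + e)}.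
  have k0 : 0 < k.+1%:R^-1 :> R by rewrite invr_gt0 ltr0n.
  have [n0 hn0] := uniform_transfer_average mF cF uniq cg k0.
  rewrite cE in hn0.
  have [h ch hE] := transfer_coboundary n0 cg.
  have [H H0 hH] := circle_continuous_bounded ch.
  have cth : continuous (transfer p F h) by exact: continuous_transfer.
  (* Both differences compare a quantity after the random step with its mean over the letter, so
     [psi] has mean 0 from every starting point. *)
  pose psi z := phi z - g z.2 + (h (F z) - transfer p F h z.2).
  have mpsi : measurable_fun setT psi.
    apply: measurable_funD; apply: measurable_funB => //.
    - exact: (measurableT_comp (circle_continuous_measurable cg) measurable_snd).
    - exact: (measurableT_comp (circle_continuous_measurable ch) mF).
    - exact: (measurableT_comp (circle_continuous_measurable cth) measurable_snd).
  have psiB z : `|psi z| <= (M + M) + (H + H).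
    have gM y : `|g y| <= M by apply: Rintegral_prob_bound => // t; exact: phiM.
    have thH y : `|transfer p F h y| <= H by exact: transfer_bound.
    apply: le_trans (ler_normD _ _) _; apply: lerD.
      by apply: le_trans (ler_normB _ _) _; exact: lerD.
    by apply: le_trans (ler_normB _ _) _; exact: lerD.
  have psi0 y : \int[p]_t psi (t, y) = 0.
    rewrite /psi/=.
    have ihF : p.-integrable setT (EFin \o (fun t => h (F (t, y)))).
      exact: (integrable_comp_F p mF y ch).
    rewrite RintegralD//; last 2 first.
    - exact: (integrableB measurableT (iphi y) (integrable_prob_cst p _)).
    - exact: (integrableB measurableT ihF (integrable_prob_cst p _)).
    rewrite RintegralB//; last exact: integrable_prob_cst.
    rewrite RintegralB//; last exact: integrable_prob_cst.
    by rewrite !Rintegral_prob_cst /transfer !subrr addr0.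
  have := birkhoff_sum_mean0 hP mF x mpsi psiB psi0.
  apply: filterS => w hw e e0.
  have e20 : 0 < e / 2 by rewrite divr_gt0.
  have [N hN] := hw _ e20.
  (* Along the path [h (F z) - transfer p F h z.2] is the increment of [h] plus
     [h - transfer p F h]. The increments telescope, and the other part replaces [g] by its
     average. *)
  have SE n : birkhoff_sum f psi n w x = birkhoff_sum f phi n w x -
      \sum_(k < n) transfer_average p F g n0 (cocycle f k w x) +
      (h (cocycle f n w x) - h x).
    elim: n => [|n ih]; first by rewrite !birkhoff_sum0 big_ord0/= !subrr addr0.
    rewrite !birkhoff_sumS big_ord_recr/= ih /psi/= /f.
    have := hE (cocycle f n w x); rewrite /f => hEn.
    by lra.
  (* The boundary term is at most [2 * H], hence at most [n * e / 2] from this index on; the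
     martingale sum takes the other half. *)
  exists (maxn N (Num.truncn (4 * H / e)).+1) => n.
  rewrite geq_max => /andP[Nn Hn].
  have h2 : 4 * H <= n%:R * e.
    rewrite -ler_pdivrMr//; apply: ltW.
    by apply: lt_le_trans (truncnS_gt _) _; rewrite ler_nat.
  have av : `|\sum_(k < n) transfer_average p F g n0 (cocycle f k w x) - n%:R * c|
      <= n%:R * k.+1%:R^-1.
    rewrite mulr_natl -[c *+ n](_ : \sum_(i < n) c = _); last first.
      by rewrite sumr_const card_ord.
    rewrite -sumrB; apply: le_trans (ler_norm_sum _ _ _) _.
    apply: le_trans (_ : \sum_(i < n) k.+1%:R^-1 <= _).
      by apply: ler_sum => i _; exact: hn0.
    by rewrite sumr_const card_ord mulr_natl.
  have := hN n Nn; rewrite SE; move: av (hH x) (hH (cocycle f n w x)).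
  have -> : n%:R * (k.+1%:R^-1 + e) = n%:R * k.+1%:R^-1 + n%:R * e by ring.
  have -> : n%:R * (e / 2) = n%:R * e / 2 by ring.
  move: h2; set u := n%:R * k.+1%:R^-1; set v := n%:R * e; set nc := n%:R * c.
  move: (birkhoff_sum _ _ _ _ _) => s; move: (\sum_(_ < _) _) => s'.
  move: (h x) (h _) => a b ?.
  rewrite !ler_norml => /andP[? ?] /andP[? ?] /andP[? ?] /andP[? ?].
  by apply/andP; split; lra.
apply: filterS (ae_foralln H) => w hw e e0.
have e20 : 0 < e / 2 by rewrite divr_gt0.
have [k hk] := inv_succ_le e20; have [N hN] := hw k _ e20.
exists N => n /hN /le_trans; apply; rewrite ler_wpM2l//.
by rewrite [leRHS](splitr e) lerD2r.
Qed.

End bounded.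

Section dominated.
Context (phi : T * circle R -> R) (mphi : measurable_fun setT phi)
  (cphi : forall t, continuous (fun x => phi (t, x))) (K : T -> R)
  (mK : measurable_fun setT K) (iK : p.-integrable setT (EFin \o K))
  (phiK : forall t x, `|phi (t, x)| <= K t).

Let K0 t : 0 <= K t. Proof. exact: le_trans (phiK t point). Qed.

(** The cut is decided by [K] at the letter and not by the value of [phi], so each section in the
    circle variable stays continuous. *)
Let trunc m z := if m%:R < K z.1 then 0 else phi z.

Let mtrunc m : measurable_fun setT (trunc m).
Proof.
apply: measurable_fun_ifT => //.
apply: measurable_fun_ltr => //.
exact: (measurableT_comp mK measurable_fst).
Qed.

Let ctrunc m t : continuous (fun x => trunc m (t, x)).
Proof.
rewrite /trunc/=; have [_|_] := ltP m%:R (K t); first exact: continuous_const.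
exact: cphi.
Qed.

Let trunc_le m z : `|trunc m z| <= m%:R.
Proof.
rewrite /trunc; case: ifPn => [_|]; first by rewrite normr0.
by case: z => t x /=; rewrite -leNgt; exact: le_trans (phiK t x).
Qed.

Let trunc_tail m t x : `|phi (t, x) - trunc m (t, x)| <= tail K m t.
Proof. by rewrite /trunc /tail/=; case: ifP; rewrite ?subr0 ?subrr ?normr0. Qed.

Lemma integrable_dominated :
  (p \x mu)%E.-integrable setT (EFin \o phi).
Proof.
apply/integrable21ltyP; first exact/measurable_EFinP.
apply: (@le_lt_trans _ _ (\int[mu]_x \int[p]_t (K t)%:E)%E).
  apply: ge0_le_integral => //.
  - by move=> x _; apply: integral_ge0.
  - apply: (measurable_fun_fubini_tonelli_G (abse \o (EFin \o phi))) => //.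
      by apply: measurableT_comp => //; exact/measurable_EFinP.
    by move=> z; rewrite /= lee_fin.
  - move=> x _; apply: ge0_le_integral => //.
    + apply: measurableT_comp => //; apply/measurable_EFinP.
      exact: (measurableT_comp mphi (pair2_measurable x)).
    + exact/measurable_EFinP.
    + by move=> t _; rewrite lee_fin.
rewrite integral_cst// [X in (_ * X)%E](@probability_setT _ _ _ mu) mule1.
have /integrableP[_] := iK.
by under eq_integral do rewrite /= ger0_norm//.
Qed.

Let integral_trunc m :
  `|\int[(p \x mu)%E]_z trunc m z - \int[(p \x mu)%E]_z phi z| <=
  \int[p]_t tail K m t.
Proof.
have itr : (p \x mu)%E.-integrable setT (EFin \o trunc m).
  exact: (@bounded_integrable _ _ _ (p \x mu)%E _ m%:R).
have iph := integrable_dominated.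
rewrite -RintegralB//.
apply: le_trans (le_normr_Rintegral _ _) _ => //; first exact: (integrableB measurableT itr iph).
have tE (x : circle R) : p.-integrable setT (EFin \o (fun t => tail K m (t, x).1)).
  exact: integrable_tail.
have mt : measurable_fun setT (fun z : T * circle R => tail K m z.1).
  exact: (measurableT_comp (measurable_tail mK m) measurable_fst).
have it : (p \x mu)%E.-integrable setT
    (EFin \o (fun z : T * circle R => tail K m z.1)).
  apply/integrable21ltyP; first exact/measurable_EFinP.
  rewrite /=; under eq_integral do under eq_integral do
    rewrite ger0_norm ?tail_ge0//.
  rewrite integral_cst// [X in (_ * X)%E](@probability_setT _ _ _ mu) mule1.
  have /integrableP[_] := integrable_tail mK K0 iK m.
  by under eq_integral do rewrite /= ger0_norm ?tail_ge0//.
have <- : \int[(p \x mu)%E]_z tail K m z.1 = \int[p]_t tail K m t.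
  by rewrite Rintegral_product//= Rintegral_prob_cst.
apply: le_Rintegral_prob => //.
  by apply: integrable_norm; exact: (integrableB measurableT itr iph).
by move=> [t x] /=; rewrite distrC; exact: trunc_tail.
Qed.

(* Truncate [phi] at a level [m] for which the tail of the dominating function
   contributes little both on average and along the path. *)
Theorem random_map_strong_law x :
  {ae P, forall w, n%:R^-1 * birkhoff_sum f phi n w x @[n --> \oo] -->
    \int[(p \x mu)%E]_z phi z}.
Proof.
have H1 := ae_foralln (fun m => bounded_strong_law (mtrunc m) (@ctrunc m)
  (trunc_le m) x).
have k0 k : 0 < k.+1%:R^-1 :> R by rewrite invr_gt0 ltr0n.
have H2 := ae_foralln (fun k => ae_sum_tail_small hP mK K0 iK (k0 k)).
apply: filterS2 H1 H2 => w h1 h2; apply/cvgrPdist_le => e e0.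
have e30 : 0 < e / 3 by rewrite divr_gt0.
have [k hk] := inv_succ_le e30.
have [m [im sm]] := h2 k; have [N hN] := h1 m _ e30.
(* Three errors of size [e / 3]: the tail along the path ([a1]), the bounded law for the truncation
   ([a2]), and the change of the integral ([a3]). The bound [1 <= n] makes division by [n]
   legitimate. *)
exists (maxn N 1) => // n /=; rewrite geq_max => /andP[Nn n0].
set c := \int[_]_z phi z; set cm := \int[(p \x mu)%E]_z trunc m z.
have n0' : 0 < n%:R :> R by rewrite ltr0n.
have -> : c - n%:R^-1 * birkhoff_sum f phi n w x =
    n%:R^-1 * (n%:R * c - birkhoff_sum f phi n w x).
  by rewrite mulrBr mulKf// gt_eqF.
rewrite normrM ger0_norm ?invr_ge0// ler_pdivrMl//.
have a1 : `|birkhoff_sum f phi n w x - birkhoff_sum f (trunc m) n w x| <=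
    n%:R * (e / 3).
  rewrite /birkhoff_sum -sumrB; apply: le_trans (ler_norm_sum _ _ _) _.
  apply: le_trans (_ : \sum_(k < n) tail K m (w k) <= _).
    by apply: ler_sum => i _; exact: trunc_tail.
  by apply: le_trans (sm n) _; rewrite ler_wpM2l.
have a2 := hN n Nn.
have a3 : `|cm - c| <= e / 3.
  by apply: le_trans (integral_trunc m) _; exact: le_trans im hk.
have a4 : `|n%:R * cm - n%:R * c| <= n%:R * (e / 3).
  by rewrite -mulrBr normrM ger0_norm// ler_wpM2l.
move: a1 a2 a4; rewrite -/cm !ler_norml => /andP[? ?] /andP[? ?] /andP[? ?].
by apply/andP; split; lra.
Qed.

End dominated.
End strong_law.

(** * The logarithmic derivative *)

Section log_derivative.
Context (R : realType).

(** A derivative written as the limit of a sequence of difference quotients inherits their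
    measurability; this serves [measurable_log_deriv]. *)
Lemma cvg_derive1_seq (h : R -> R) : derivable h 0 1 ->
  n.+1%:R * (h n.+1%:R^-1 - h 0) @[n --> \oo] --> derive1 h 0.
Proof.
move=> dh; rewrite derive1E.
have c0 : n.+1%:R^-1 @[n --> \oo] --> (0 : R)^'.
  move=> A hA.
  have H : \forall n \near \oo, n.+1%:R^-1 != 0 :> R -> A n.+1%:R^-1.
    exact: (@cvg_harmonic R _ hA).
  have : \forall n \near \oo, A n.+1%:R^-1.
    by apply: filterS H => n; apply; rewrite invr_eq0 pnatr_eq0.
  by [].
have : (fun r : R => r^-1 *: ((h \o shift 0) (r *: 1) - h 0)) @ 0^' --> 'D_1 h 0.
  exact: dh.
move=> /(cvg_comp _ _ c0); apply: cvg_trans; apply: near_eq_cvg.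
by apply: nearW => n; rewrite /= invrK addr0 /GRing.scale/= mulr1.
Qed.

(** Nonvanishing of the derivative belongs to the induction, because [ln] turns a product into a sum
    only for positive factors. *)
Lemma ln_deriv_cocycle d (T : measurableType d) (f : T -> circle R -> circle R)
    (w : paths T) n : (forall k, circle_C1_diffeo (f (w k))) ->
  circle_C1 (cocycle f n w) /\ forall x,
  circle_deriv (cocycle f n w) x != 0 /\
  ln `|circle_deriv (cocycle f n w) x| =
    \sum_(k < n) ln `|circle_deriv (f (w k)) (cocycle f k w x)|.
Proof.
move=> df; elim: n => [|n [C1n ih]].
  split=> [|x]; first exact: circle_C1_id.
  by rewrite circle_deriv_id big_ord0 normr1 ln1.
have C1f := (df n).1.
split=> [|x]; first exact: circle_C1_comp.
have [n0 lnE] := ih x.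
have [_ _ /= ->] := circle_deriv_comp x C1n C1f.
have f0 := circle_C1_diffeo_deriv_neq0 (cocycle f n w x) (df n).
rewrite mulf_neq0// big_ord_recr/= -lnE normrM lnM ?posrE ?normr_gt0//.
by rewrite addrC.
Qed.

Section measurability.
Context d (T : measurableType d) (F : T * circle R -> circle R)
  (mF : measurable_fun setT F)
  (dF : forall t, circle_C1_diffeo (fun x => F (t, x))).

Definition log_deriv (z : T * circle R) : R :=
  ln `|circle_deriv (fun x => F (z.1, x)) z.2|.

Let measurable_rotated (s : R) :
  measurable_fun setT (fun z : T * circle R => F (z.1, rotate s z.2)).
Proof.
apply: (measurableT_comp mF); apply/measurable_fun_pair => //.
exact: (measurableT_comp (continuous_circle_measurable (@continuous_rotate R s))
  measurable_snd).
Qed.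

Let measurable_arc (j : circle R -> R) (s : R) : continuous j ->
  measurable_fun setT (fun z : T * circle R => j (F (z.1, rotate s z.2))).
Proof.
move=> cj.
exact: (measurableT_comp (circle_continuous_measurable cj) (measurable_rotated s)).
Qed.

Let measurable_derive_arc (j : circle R -> R) : continuous j ->
  (forall z : T * circle R,
     derivable (fun s : R => j (F (z.1, rotate s z.2))) 0 1) ->
  measurable_fun setT (fun z : T * circle R =>
    derive1 (fun s : R => j (F (z.1, rotate s z.2))) 0).
Proof.
move=> cj dj.
apply: (measurable_fun_cvg (h := fun n z => n.+1%:R *
  (j (F (z.1, rotate n.+1%:R^-1 z.2)) - j (F (z.1, rotate 0 z.2))))).
  move=> n; apply: measurable_funM => //; apply: measurable_funB.
    exact: measurable_arc.
  exact: measurable_arc.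
by move=> z _; exact: cvg_derive1_seq (dj z).
Qed.

Lemma measurable_log_deriv : measurable_fun setT log_deriv.
Proof.
have d1 (z : T * circle R) :
    derivable (fun s : R => (val (F (z.1, rotate s z.2))).1) 0 1.
  exact: ((dF z.1).1.1 z.2).1.
have d2 (z : T * circle R) :
    derivable (fun s : R => (val (F (z.1, rotate s z.2))).2) 0 1.
  exact: ((dF z.1).1.1 z.2).2.
have m1 := measurable_derive_arc (@continuous_circle1 R) d1.
have m2 := measurable_derive_arc (@continuous_circle2 R) d2.
have c1 : measurable_fun setT (fun z : T * circle R => (val (F z)).1).
  exact: measurableT_comp (circle_continuous_measurable (@continuous_circle1 R)) mF.
have c2 : measurable_fun setT (fun z : T * circle R => (val (F z)).2).
  exact: measurableT_comp (circle_continuous_measurable (@continuous_circle2 R)) mF.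
have mD : measurable_fun setT
    (fun z : T * circle R => circle_deriv (fun x => F (z.1, x)) z.2).
  rewrite (_ : (fun z => _) = fun z : T * circle R =>
      (val (F z)).1 * derive1 (fun s : R => (val (F (z.1, rotate s z.2))).2) 0 -
      (val (F z)).2 * derive1 (fun s : R => (val (F (z.1, rotate s z.2))).1) 0).
    by apply: measurable_funB; exact: measurable_funM.
  by apply/funext => -[t x].
apply: (measurableT_comp (@measurable_ln R)).
exact: (measurableT_comp _ mD).
Qed.

Lemma continuous_log_deriv t : continuous (fun x => log_deriv (t, x)).
Proof.
move=> x; have d0 := circle_C1_diffeo_deriv_neq0 x (dF t).
have c1 : `|circle_deriv (fun y => F (t, y)) y| @[y --> x] -->
          `|circle_deriv (fun y => F (t, y)) x|.
  by apply: continuous_normr; exact: (dF t).1.2.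
have c2 : ln y @[y --> `|circle_deriv (fun y => F (t, y)) x|] -->
          ln `|circle_deriv (fun y => F (t, y)) x|.
  by apply: continuous_ln; rewrite normr_gt0.
exact: (cvg_comp _ _ c1 c2).
Qed.

Lemma log_deriv_birkhoff n (w : paths T) x :
  ln `|circle_deriv (cocycle (fun t x => F (t, x)) n w) x| =
  birkhoff_sum (fun t x => F (t, x)) log_deriv n w x.
Proof.
have [_ h] := @ln_deriv_cocycle _ _ (fun t x => F (t, x)) w n (fun k => dF (w k)).
by have [_ ->] := h x.
Qed.

End measurability.
End log_derivative.

Section nonmeasurable_integral.
Context d (X : measurableType d) (R : realType) (m : {measure set X -> \bar R}).
Local Open Scope ereal_scope.

Import HBNNSimple.

(* The integral of a function that is not assumed measurable is a lower
   integral; it still ignores null sets. *)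
Let ge0_le_integral_null (N : set X) (f g : X -> \bar R) :
  measurable N -> m N = 0 -> (forall x, 0 <= f x) -> (forall x, 0 <= g x) ->
  (forall x, ~ N x -> f x = g x) -> \int[m]_x f x <= \int[m]_x g x.
Proof.
move=> mN N0 f0 g0 fg; rewrite (ge0_integralTE _ f0) (ge0_integralTE _ g0).
apply: ge_ereal_sup => _ [h hf <-].
have mN' : measurable (~` N) by exact: measurableC.
(* Cut to the complement of [N], a simple function below [f] lies below [g] everywhere and keeps its
   integral. *)
apply: ereal_sup_ubound; exists (proj_nnsfun h mN') => [x|] /=.
  rewrite mindicE; have [|] := boolP (x \in ~` N).
    by move=> /set_mem Nx; rewrite mulr1 -fg.
  by rewrite mulr0.
rewrite -!integralT_nnsfun; apply: ae_eq_integral => //.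
- by apply/measurable_EFinP.
- by apply/measurable_EFinP.
exists N; split=> // x /= h1; apply: contrapT => Nx; apply: h1 => _.
by rewrite mindicE mem_set// mulr1.
Qed.

(** Applied to [lyapunov], whose integrand involves [f0] and need not be measurable. *)
Lemma integral_eq_null (N : set X) (f g : X -> \bar R) :
  measurable N -> m N = 0 -> (forall x, ~ N x -> f x = g x) ->
  \int[m]_x f x = \int[m]_x g x.
Proof.
move=> mN N0 fg; rewrite [LHS]integralE [RHS]integralE.
have fgp x : ~ N x -> f^\+ x = g^\+ x by move=> /fg h; rewrite !funeposE h.
have fgn x : ~ N x -> f^\- x = g^\- x by move=> /fg h; rewrite !funenegE h.
congr (_ - _); apply/eqP; rewrite eq_le; apply/andP; split;
  apply: (ge0_le_integral_null mN N0) => // x Nx; rewrite ?fgp ?fgn//.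
Qed.

End nonmeasurable_integral.

(** * Stationary measures and the Lyapunov exponent *)

Section stationary_laws.
Context d (T : measurableType d) (R : realType) (p : probability T R)
  (P : probability (paths T) R) (hP : is_product_measure p P)
  (F : T * circle R -> circle R) (mF : measurable_fun setT F)
  (fF : paths T * circle R -> circle R) (mfF : measurable_fun setT fF)
  (fFE : {ae P, forall w, forall x, fF (w, x) = F (w 0%N, x)}).

Lemma measurable_skew_product : measurable_fun setT (skew_product fF).
Proof.
apply/measurable_fun_pair => //.
exact: (measurableT_comp (@measurable_path_shift _ T) measurable_fst).
Qed.

(** The new path depends on the letters from the second on and the new point on the first letter and
    [x]; their independence gives the product. *)
Lemma skew_product_rectangle (nu : probability (circle R) R) C A :
  measurable C -> measurable A ->
  ((P \x nu) (skew_product fF @^-1` (C `*` A)) =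
   P C * (p \x nu) (F @^-1` A))%E.
Proof.
move=> mC mA; set D := _ @^-1` (C `*` A).
have mD : measurable D.
  rewrite -[X in measurable X]setTI; apply: measurable_skew_product => //.
  exact: measurableX.
have mFA : measurable (F @^-1` A).
  by rewrite -[X in measurable X]setTI; exact: mF.
pose q t := nu (xsection (F @^-1` A) t).
have mq : measurable_fun setT q by exact: measurable_fun_xsection.
have q0 t : (0 <= q t)%E by exact: measure_ge0.
have mq0 : measurable_fun setT (fun w : paths T => q (w 0%N)).
  exact: (measurableT_comp mq (measurable_coordinate 0)).
have m1C : measurable_fun setT (fun w : paths T => (\1_C w)%:E : \bar R).
  by apply/measurable_EFinP; exact: measurable_indic.
have mC1 : measurable_fun setT
    (fun w : paths T => (\1_C (path_shift w))%:E : \bar R).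
  exact: (measurableT_comp m1C (@measurable_path_shift _ T)).
have mh : measurable_fun setT
    (fun w : paths T => (\1_C (path_shift w))%:E * q (w 0%N))%E.
  exact: emeasurable_funM.
have h0 w : (0 <= (\1_C (path_shift w))%:E * q (w 0%N))%E.
  by apply: mule_ge0 => //; rewrite lee_fin.
transitivity (\int[P]_w ((\1_C (path_shift w))%:E * q (w 0%N)))%E.
  apply: ae_eq_integral => //; first exact: measurable_fun_xsection.
  apply: filterS fFE => w Fw _ /=.
  rewrite indicE; have [/set_mem Cw|/negP Cw] := boolP (_ \in C).
    rewrite mul1e /q; congr (nu _); apply/seteqP; split=> x.
      by move=> /xsectionP [_ /=]; rewrite /= Fw => ?; exact/xsectionP.
    by move=> /xsectionP /=; rewrite -Fw => ?; apply/xsectionP; split.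
  rewrite mul0e -[RHS](measure0 nu); congr (nu _); apply/seteqP; split=> // x.
  by move=> /xsectionP [Cw' _]; apply: Cw; exact: mem_set.
rewrite (ge0_integral_cons hP)// /path_shift/=.
transitivity (\int[p]_t (P C * q t))%E.
  apply: eq_integral => t _; rewrite ge0_integralZr//.
  by rewrite integral_indic// setIT.
rewrite ge0_integralZl//.
Qed.

Lemma stationary_invariant_law (nu : probability (circle R) R) :
  stationary P fF nu -> invariant_law p F nu.
Proof.
move=> st A mA.
have := st (setT `*` A) (measurableX measurableT mA).
rewrite skew_product_rectangle// product_measure1E//.
move=> E; rewrite -[LHS]mul1e -[RHS]mul1e.
apply: eq_trans (eq_trans _ E) _; congr (_ * _)%E; last exact: probability_setT.
exact/esym/probability_setT.
Qed.

(** By the rectangle formula the image measure agrees with [P \x nu] on rectangles, which determine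
    the product measure. *)
Lemma invariant_law_stationary (nu : probability (circle R) R) :
  invariant_law p F nu -> stationary P fF nu.
Proof.
move=> inv A mA.
pose s : {mfun _ >-> _} :=
  HB.pack (skew_product fF) (isMeasurableFun.Build _ _ _ _ _ measurable_skew_product).
apply/esym.
apply: (@product_measure_unique _ _ _ _ _ P nu (pushforward (P \x nu)%E s)) => //.
move=> C B mC mB; rewrite /pushforward.
apply: eq_trans (skew_product_rectangle nu mC mB) _.
by congr (_ * _)%E; exact: inv.
Qed.

End stationary_laws.

Section lyapunov_exponent.
Context d (T : measurableType d) (R : realType) (p : probability T R)
  (P : probability (paths T) R) (hP : is_product_measure p P)
  (F : T * circle R -> circle R) (mF : measurable_fun setT F)
  (mu : probability (circle R) R) (inv_mu : invariant_law p F mu)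
  (phi : T * circle R -> R) (mphi : measurable_fun setT phi)
  (iphi : (p \x mu)%E.-integrable setT (EFin \o phi)).

Let f t x := F (t, x).

Let first (z : paths T * circle R) : T * circle R := (z.1 0%N, z.2).

Let mfirst : measurable_fun setT first.
Proof.
apply/measurable_fun_pair => //.
exact: (measurableT_comp (measurable_coordinate 0) measurable_fst).
Qed.

Let first_preserving A : measurable A ->
  (P \x mu)%E (first @^-1` A) = (p \x mu)%E A.
Proof.
move=> mA; transitivity (\int[P]_w mu (xsection A (w 0%N)))%E.
  apply: eq_integral => w _.
  have -> : xsection A (w 0%N) = xsection (first @^-1` A) w; last by [].
  by apply/seteqP; split=> x /xsectionP ?; exact/xsectionP.
apply: (@ge0_integral_coordinate0 _ _ _ _ _ hP (fun t => mu (xsection A t))).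
  exact: measurable_fun_xsection.
by move=> t; exact: measure_ge0.
Qed.

(** [F \o first] is a version of the random map without exceptional paths, so the recursion for
    Birkhoff sums holds at every point. *)
Let skew : paths T * circle R -> paths T * circle R := skew_product (F \o first).

Let mskew : measurable_fun setT skew.
Proof. by apply: measurable_skew_product; exact: measurableT_comp. Qed.

Let skew_preserving A : measurable A -> (P \x mu)%E (skew @^-1` A) = (P \x mu)%E A.
Proof.
apply: (invariant_law_stationary hP mF) => //.
  exact: measurableT_comp.
by apply: aeW.
Qed.

(** The sum is its first term plus a shorter sum at the image under [skew]. Since [first] and [skew]
    carry the measures to each other, every term has the same integral. *)
Lemma integral_birkhoff_sum n :
  (P \x mu)%E.-integrable setT
    (EFin \o (fun z => birkhoff_sum f phi n z.1 z.2)) /\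
  \int[(P \x mu)%E]_z birkhoff_sum f phi n z.1 z.2 =
    n%:R * \int[(p \x mu)%E]_z phi z.
Proof.
elim: n => [|n [ih1 ih2]].
  rewrite (_ : (fun z => _) = fun=> 0); last first.
    by apply/funext => z; exact: birkhoff_sum0.
  split; first exact: (@integrable_prob_cst _ _ _ (P \x mu)%E).
  by rewrite (@Rintegral_prob_cst _ _ _ (P \x mu)%E) mul0r.
pose S z := birkhoff_sum f phi n z.1 z.2.
have SE : (fun z => birkhoff_sum f phi n.+1 z.1 z.2) =
    fun z => phi (first z) + S (skew z).
  by apply/funext => z; rewrite birkhoff_sum_shift.
have i1 : (P \x mu)%E.-integrable setT (EFin \o (phi \o first)).
  exact: (integrable_preserving mfirst first_preserving iphi).
have i2 : (P \x mu)%E.-integrable setT (EFin \o (S \o skew)).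
  exact: (integrable_preserving mskew skew_preserving ih1).
have E1 : \int[(P \x mu)%E]_z phi (first z) = \int[(p \x mu)%E]_z phi z.
  congr fine; apply: (integral_preserving mfirst first_preserving (h := EFin \o phi)).
    exact/measurable_EFinP.
  exact: i1.
have E2 : \int[(P \x mu)%E]_z S (skew z) = \int[(P \x mu)%E]_z S z.
  congr fine; apply: (integral_preserving mskew skew_preserving (h := EFin \o S)).
    by apply/measurable_EFinP; exact: measurable_birkhoff_sum.
  exact: i2.
rewrite SE; split; first exact: (integrableD measurableT i1 i2).
by rewrite RintegralD// E1 E2 ih2 -natr1 mulrDl mul1r addrC.
Qed.

End lyapunov_exponent.

(** * Almost everywhere defined random maps *)

Section one_step_version.
Context d (T : measurableType d) (R : realType) (p : probability T R)
  (P : probability (paths T) R) (hP : is_product_measure p P).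

Lemma ae_exists (Q : paths T -> Prop) : {ae P, forall w, Q w} -> exists w, Q w.
Proof.
move=> [N [mN N0 QN]]; apply: contrapT => /forallNP nQ.
have NT : N = setT by apply/seteqP; split=> // w _; apply: QN; exact: nQ.
have : (1 = 0 :> \bar R)%E by rewrite -N0 NT; exact/esym/probability_setT.
by move=> /eqP; rewrite onee_eq0.
Qed.

(* A random map depends on the first coordinate only almost surely, through a
   family [f0] which is not assumed measurable; freezing the future of the path
   at a generic [w] turns it into a jointly measurable family. *)
Lemma exists_generic_future (N : set (paths T)) (k : paths T -> \bar R) :
  measurable N -> P N = 0%E -> P.-integrable setT k ->
  exists w, p [set t | N (path_cons (t, w))] = 0%E /\
    p.-integrable setT (fun t => k (path_cons (t, w))).
Proof.
move=> mN N0 ik; have mcons := @measurable_path_cons _ T.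
have pres A : measurable A -> (p \x P)%E (@path_cons _ T @^-1` A) = P A.
  by move=> mA; rewrite -(product_measure_cons hP).
have ik' := integrable_preserving mcons pres ik.
have hk := ae_integrable2 ik'.
pose N' := @path_cons _ T @^-1` N.
have mN' : measurable N' by rewrite -[X in measurable X]setTI; exact: mcons.
have mI : measurable_fun setT (fun z : T * paths T => (\1_N' z)%:E : \bar R).
  by apply/measurable_EFinP; exact: measurable_indic.
have I0 (z : T * paths T) : (0 <= (\1_N' z)%:E :> \bar R)%E by rewrite lee_fin.
have slice w : measurable [set t | N (path_cons (t, w))].
  rewrite -[X in measurable X]setTI.
  exact: (measurableT_comp mcons (pair2_measurable w)).
have sliceE w : (\int[p]_t (\1_N' (t, w))%:E)%E = p [set t | N (path_cons (t, w))].
  by have := integral_indic p measurableT (slice w); rewrite setIT.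
have mslice : measurable_fun setT (fun w => (\int[p]_t (\1_N' (t, w))%:E)%E).
  exact: (measurable_fun_fubini_tonelli_G (fun z => (\1_N' z)%:E)).
have hN : {ae P, forall w, p [set t | N (path_cons (t, w))] = 0%E}.
  have : ae_eq P setT (fun w => (\int[p]_t (\1_N' (t, w))%:E)%E) (cst 0%E).
    apply/ae_eq_integral_abs => //.
    under eq_integral do rewrite gee0_abs ?integral_ge0//.
    rewrite -(fubini_tonelli2 (fun z => (\1_N' z)%:E))//.
    by rewrite integral_indic// setIT; exact: eq_trans (pres _ mN) N0.
  by apply: filterS => w /(_ I); rewrite sliceE.
have [w [h1 h2]] := ae_exists (filterI hN hk).
by exists w.
Qed.

End one_step_version.

Theorem proposition19 (R : realType) (d : measure_display)
    (T : measurableType d) (p : probability T R)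
    (P : probability (paths T) R) (hP : is_product_measure p P)
    (f : paths T * circle R -> circle R) (f0 : T -> circle R -> circle R)
    (hf : random_map P f f0)
    (hdiffeo : {ae P, forall w, circle_C1_diffeo (fun x => f (w, x))})
    (hint : ae_integrable P (fun w => log_deriv_norm (fun x => f (w, x))))
    (hue : uniquely_ergodic P f)
    (mu : probability (circle R) R) (hmu : stationary P f mu)
    (x : circle R) :
  {ae P, forall w,
    (fun n : nat =>
       (n%:R^-1 * ln `|circle_deriv (cocycle f0 n w) x|)%:E) @ \oo
    --> lyapunov P f0 mu}.
Proof.
have [mf ff0] := hf; have [k ik hk] := hint.
pose good w := [/\ forall y, f (w, y) = f0 (w 0%N) y,
  circle_C1_diffeo (fun y => f (w, y)),
  log_deriv_norm (fun y => f (w, y)) = k w & k w \is a fin_num].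
have [N [mN N0 goodN]] : {ae P, forall w, good w}.
  have kfin := integrable_ae measurableT ik.
  apply: filterS2 (filterI ff0 hdiffeo) (filterI hk kfin) => w [a b] [c e].
  by split=> //; [exact: c|exact: e].
have {}goodN w : ~ N w -> good w by move=> Nw; apply: contrapT => /goodN.
have [w' [pN ik']] := exists_generic_future hP mN N0 ik.
pose T1 := [set t | ~ N (path_cons (t, w'))].
have mNt : measurable [set t | N (path_cons (t, w'))].
  rewrite -[X in measurable X]setTI.
  exact: (measurableT_comp (@measurable_path_cons _ T) (pair2_measurable w')).
have mT1 : measurable T1 by exact: measurableC mNt.
have pT1 : p T1 = 1%E.
  by rewrite (_ : T1 = ~` [set t | N (path_cons (t, w'))])// probability_setC// pN sube0.
(* With the tail frozen at [w'], joint measurability comes from [f]. The identity on the remaining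
   letters makes every section a diffeomorphism, with logarithmic derivative 0. *)
pose F z := if z.1 \in T1 then f (path_cons (z.1, w'), z.2) else z.2.
have mbT1 : measurable_fun setT (fun t => t \in T1).
  apply: (measurable_fun_bool true).
  rewrite setTI (_ : _ @^-1` _ = T1)//.
  by apply/seteqP; split=> t /=; [move=> /set_mem|move=> /mem_set].
have mF : measurable_fun setT F.
  apply: measurable_fun_ifT => //.
    exact: (measurableT_comp mbT1 measurable_fst).
  apply: (measurableT_comp mf); apply/measurable_fun_pair => //.
  have m1 := measurableT_comp (@measurable_path_cons _ T) (pair2_measurable w').
  exact: (measurableT_comp m1 measurable_fst).
have FT t : T1 t -> (fun y => F (t, y)) = fun y => f (path_cons (t, w'), y).
  by move=> T1t; apply/funext => y; rewrite /F/= mem_set.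
have FnT t : ~ T1 t -> (fun y => F (t, y)) = id.
  by move=> T1t; apply/funext => y; rewrite /F/= memNset.
have dF t : circle_C1_diffeo (fun y => F (t, y)).
  have [T1t|T1t] := pselect (T1 t); first by rewrite FT//; case: (goodN _ T1t).
  by rewrite FnT//; exact: circle_C1_diffeo_id.
have cF t : continuous (fun y => F (t, y)).
  exact: circle_C1_continuous (dF t).1.
pose phi := log_deriv F.
have mphi : measurable_fun setT phi by exact: measurable_log_deriv.
have cphi t : continuous (fun y => phi (t, y)) by exact: continuous_log_deriv.
(* On [T1] the value of [k] is finite and equals [log_deriv_norm] of the section; elsewhere the
   section is the identity, and 0 dominates. *)
pose K t := if t \in T1 then fine `|k (path_cons (t, w'))|%E else 0.
have /integrableP[mk _] := ik'.
have mK : measurable_fun setT K.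
  apply: measurable_fun_ifT => //.
  have mka : measurable_fun setT (fun t => `|k (path_cons (t, w'))|%E).
    exact: measurableT_comp.
  exact: (measurableT_comp (fine_measurable measurableT) mka).
have iK : p.-integrable setT (EFin \o K).
  apply: le_integrable ik' => //; first exact/measurable_EFinP.
  move=> t _; rewrite /= /K; have [/set_mem T1t|_] := boolP (t \in T1).
    have [_ _ _ kfin] := goodN _ T1t.
    by rewrite ger0_norm ?fine_ge0// fineK ?abse_fin_num.
  by rewrite normr0 abse_ge0.
have phiK t y : `|phi (t, y)| <= K t.
  rewrite /phi /log_deriv /K/=; have [/set_mem T1t|/negP T1t] := boolP (t \in T1).
    have [_ _ kE kfin] := goodN _ T1t.
    rewrite FT// -lee_fin fineK ?abse_fin_num//; apply: le_trans (lee_abs _).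
    by rewrite -kE; apply: ereal_sup_ubound; exists y.
  rewrite FnT; last by move=> h; apply: T1t; exact: mem_set.
  by rewrite circle_deriv_id normr1 ln1 normr0.
have coordT1 := ae_coordinates hP mT1 pT1.
(* Both sides equal [f0 (w 0) y], since [w] and the path with the same first letter and frozen tail
   [w'] are good; the tail leaves no trace. *)
have fFE : {ae P, forall w, forall y, f (w, y) = F (w 0%N, y)}.
  apply: filterS2 ff0 coordT1 => w fw T1w y.
  have := FT _ (T1w 0%N) => /(congr1 (@^~ y)) -> /=.
  by rewrite fw; have [-> _ _ _] := goodN _ (T1w 0%N).
have inv_mu := stationary_invariant_law hP mF mf fFE hmu.
have uniq nu : invariant_law p F nu -> forall A, measurable A -> nu A = mu A.
  move=> /(invariant_law_stationary hP mF mf fFE) st A mA.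
  have [mu0 [_ uniq0]] := hue.
  by rewrite (uniq0 nu)// (uniq0 mu).
have derivE w n y : (forall m, T1 (w m)) ->
    ln `|circle_deriv (cocycle f0 n w) y| =
    birkhoff_sum (fun t z => F (t, z)) phi n w y.
  move=> T1w; rewrite -log_deriv_birkhoff//.
  rewrite (@eq_cocycle _ _ _ f0 (fun t z => F (t, z)))// => m.
  rewrite FT//; apply/funext => z.
  by have [-> _ _ _] := goodN _ (T1w m).
have lyapE : lyapunov P f0 mu = (\int[(p \x mu)%E]_z phi z)%:E.
  have iphi := integrable_dominated mu mphi mK iK phiK.
  have [M [mM M0 T1M]] := coordT1.
  (* The sequence is constant from 1 on; index 0 is excluded because the inverse of 0 is 0. *)
  apply: cvg_lim => //; apply: cvg_near_cst; exists 1%N => // n /= n0.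
  have [iS ES] := integral_birkhoff_sum hP mF inv_mu mphi iphi n.
  (* [f0] is under control only along paths with all letters in [T1]; the other paths lie in the
     null set [M]. *)
  rewrite (@integral_eq_null _ _ _ (P \x mu)%E (M `*` setT) _
    (EFin \o (fun z => birkhoff_sum (fun t z => F (t, z)) phi n z.1 z.2))).
  - rewrite -[X in (_ * X)%E]fineK; last exact: integrable_fin_num iS.
    by rewrite -EFinM -/(Rintegral _ _ _) ES mulKf// pnatr_eq0 -lt0n.
  - exact: measurableX.
  - apply: eq_trans (product_measure1E _ _ mM measurableT) _.
    by rewrite [X in (X * _)%E]M0 mul0e.
  - move=> z Mz; rewrite /= derivE//.
    by apply: contrapT => h; apply: Mz; split=> //; exact: T1M.
have H := random_map_strong_law hP mF cF uniq mphi cphi mK iK phiK x.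
apply: filterS2 H coordT1 => w Hw T1w; rewrite lyapE.
apply: cvg_EFin; first exact: nearW.
by under eq_fun do rewrite /= derivE//.
Qed.
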